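(* Let $F_0$ be the solution of $F_0'' = -3Q(t)^2F_0$ for $t > 0$ with $F_0(0) = 0$, $F_0'(0) = -1$, and let $t_0 > 0$ be the first positive zero of $F_0$. Let $q$ solve $$q''(t) = -3Q(t+t_0)^2\,q(t), \quad t > 0, \qquad q(0) = 0,\ q'(0) = 1.$$ Then $q(t) > 0$ for all $0 < t < \infty$. Furthermore, there is a constant $c_0 > 0$ with $\min_{t \ge 1}\frac{q(t)}{t} \ge c_0$.
   Context: $Q(t)$, $t\ge 0$, denotes the radial profile of the positive radial ground state of $\Delta\phi - \phi + |\phi|^2\phi = 0$ on $\mathbb{R}^3$; it solves $-Q'' - \frac{2}{t}Q' + Q - Q^3 = 0$. The first positive zero $t_0$ of $F_0$ exists; this is the case $\epsilon = 0$ of the paper's sign-change lemma. *)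

(* Defs.v *)
From Stdlib Require Import Reals.
From Coquelicot Require Import Coquelicot.
Open Scope R_scope.

(* Q is (an even extension to R of) the radial profile of the positive radial
   ground state of  Delta phi - phi + phi^3 = 0  on R^3:
   Q > 0 on [0,oo), Q is differentiable, Q'(0) = 0 (regularity at the origin),
   -Q'' - (2/t) Q' + Q - Q^3 = 0 for t > 0, and Q(t) -> 0 as t -> oo. *)
Definition radial_ground_state (Q : R -> R) : Prop :=
  (forall t, 0 <= t -> 0 < Q t) /\
  (forall t, ex_derive Q t) /\
  Derive Q 0 = 0 /\
  (forall t, 0 < t ->
     is_derive (Derive Q) t (- (2 / t) * Derive Q t + Q t - Q t ^ 3)) /\
  is_lim Q p_infty 0.

(* f solves  f'' = -3 V(t)^2 f  for t > 0 with f(0) = a, f'(0) = b.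
   f' is the derivative of f (on all of R, so that f'(0) makes sense);
   the second-order equation is imposed only for t > 0. *)
Definition solves_ivp (V : R -> R) (a b : R) (f : R -> R) : Prop :=
  (forall t, ex_derive f t) /\
  f 0 = a /\ Derive f 0 = b /\
  (forall t, 0 < t -> is_derive (Derive f) t (- 3 * (V t) ^ 2 * f t)).

Definition first_pos_zero (f : R -> R) (t0 : R) : Prop :=
  0 < t0 /\ f t0 = 0 /\ (forall t, 0 < t < t0 -> f t <> 0).

(* Main.v *)
Require Import Defs.
From Stdlib Require Import Reals.
From Coquelicot Require Import Coquelicot.
From Stdlib Require Import ZArith List Lra Lia Psatz Bool Classical.
Import ListNotations.
Open Scope R_scope.

(** Put [al = 1 / Q 0] and [w x = al * Q (al * x / 2)], so that [w 0 = 1] and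
    [x w'' + 2 w' = x (al^2 w - w^3) / 4].  A positive solution tending to 0 is
    decreasing, has [al^2 <= 1/2], and [U = x w] satisfies
    [U' >= - (al / 2) U] and [4 U'^2 >= U^2 (al^2 - w^2 / 2)].  An arbitrary
    solution violates one of these two inequalities quickly unless [al] is close
    to its true value 0.2306.  On each unit cell of [x] and on each of finitely
    many intervals of [al], [w] is compared with a polynomial in [x] and [al]
    with integer coefficients whose residual is bounded exactly; Gronwall's
    inequality turns the residual into an error bound.  This excludes every [al]
    outside [0.228, 0.232].

    For [al] in this window the same method follows the solution [f] of
    [f'' = - (3/4) w^2 f], [f 0 = 0], [f' 0 = 1] (a multiple of [F0] in the
    variable [x]) up to [x = 14]: it has a single zero and decreases from there
    on.  Beyond [x = 14] an explicit Riccati supersolution keeps [f'] below a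
    negative constant.  By uniqueness [q] is a multiple of [F0] shifted by [t0],
    so it grows at least linearly. *)

(** * Polynomials with integer coefficients *)

(** The hypotheses describe [Q] by its limit at infinity and leave [Q 0] open, so this value has to
    be located by shooting, with arguments valid for every positive decaying solution. As
    [al = 1 / Q 0], a parameter below the true value yields a solution heading for a zero, one above
    it a solution that turns back towards the constant [al]. The two inequalities on [U = x w]
    express that neither happens, and they fail well before a zero or a turning point is reached,
    while the error bounds are still small. Errors are measured on [U] because
    [U'' = x (al^2 w - w^3) / 4] has no first-order term and no singular coefficient: Gronwall's
    inequality can start at the origin. The parameter stays symbolic, as a polynomial in [y] with
    [|y| <= 1]. This keeps the correlation between value, derivative and parameter from cell to
    cell, so that wide intervals of [al] can be treated at once. *)

Fixpoint gadd {C} (add : C -> C -> C) (p q : list C) : list C :=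
  match p, q with
  | [], _ => q
  | _, [] => p
  | a :: p', b :: q' => add a b :: gadd add p' q'
  end.

Fixpoint gmul {C} (zero : C) (add mul : C -> C -> C) (p q : list C) : list C :=
  match p with
  | [] => []
  | a :: p' => gadd add (map (mul a) q) (zero :: gmul zero add mul p' q)
  end.

(** Product rule for [a + x p], which avoids multiplying coefficients by their index. *)
Fixpoint gder {C} (zero : C) (add : C -> C -> C) (p : list C) : list C :=
  match p with
  | [] => []
  | a :: p' => gadd add p' (zero :: gder zero add p')
  end.

(** [h] evaluates one coefficient: it is [IZR] for polynomials in [y] and [pev y] for polynomials in
    [x], so each evaluation law is proved once for both levels. *)
Definition gev {C} (h : C -> R) (x : R) (p : list C) : R :=
  fold_right (fun c s => h c + x * s) 0 p.

Lemma gev_add {C} (h : C -> R) add x :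
  (forall a b, h (add a b) = h a + h b) ->
  forall p q, gev h x (gadd add p q) = gev h x p + gev h x q.
Proof.
intros H p; induction p as [|a p IH]; intros [|b q]; simpl; try ring.
change (h (add a b) + x * gev h x (gadd add p q) =
  h a + x * gev h x p + (h b + x * gev h x q)).
rewrite H, IH; ring.
Qed.

Lemma gev_map {C} (h : C -> R) x (f : C -> C) c :
  (forall a, h (f a) = c * h a) ->
  forall p, gev h x (map f p) = c * gev h x p.
Proof.
intros H p; induction p as [|a p IH]; simpl; [ring|].
change (h (f a) + x * gev h x (map f p) = c * (h a + x * gev h x p)).
rewrite H, IH; ring.
Qed.

Lemma gev_mul {C} (h : C -> R) zero add mul x :
  h zero = 0 ->
  (forall a b, h (add a b) = h a + h b) ->
  (forall a b, h (mul a b) = h a * h b) ->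
  forall p q, gev h x (gmul zero add mul p q) = gev h x p * gev h x q.
Proof.
intros H0 H1 H2 p q; induction p as [|a p IH]; [simpl; ring|].
change (gev h x (gadd add (map (mul a) q) (zero :: gmul zero add mul p q)) =
  (h a + x * gev h x p) * gev h x q).
rewrite gev_add by assumption.
rewrite (gev_map h x (mul a) (h a)) by (intros; apply H2).
change (gev h x (zero :: gmul zero add mul p q))
  with (h zero + x * gev h x (gmul zero add mul p q)).
rewrite IH, H0; ring.
Qed.

Lemma is_derive_gev {C} (h : C -> R) zero add :
  h zero = 0 -> (forall a b, h (add a b) = h a + h b) ->
  forall p x, is_derive (fun t => gev h t p) x (gev h x (gder zero add p)).
Proof.
intros H0 H1 p; induction p as [|a p IH]; intros x.
- exact (@is_derive_const R_AbsRing R_NormedModule 0 x).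
- simpl gder; rewrite gev_add by assumption.
  change (gev h x (zero :: gder zero add p))
    with (h zero + x * gev h x (gder zero add p)).
  change (is_derive (fun t => h a + t * gev h t p) x
    (gev h x p + (h zero + x * gev h x (gder zero add p)))).
  replace (gev h x p + (h zero + x * gev h x (gder zero add p)))
    with (plus 0 (plus (mult 1 (gev h x p)) (mult x (gev h x (gder zero add p)))))
    by (unfold plus, mult; simpl; rewrite H0; ring).
  apply (is_derive_plus (fun _ => h a) (fun t => t * gev h t p)).
  + exact (@is_derive_const R_AbsRing R_NormedModule (h a) x).
  + apply (is_derive_mult (fun t => t) (fun t => gev h t p)).
    * exact (@is_derive_id R_AbsRing x).
    * apply IH.
    * intros; apply Rmult_comm.
Qed.

(* A [list Z] is a polynomial in [y]; a [list (list Z)] is a polynomial in [x]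
   whose coefficients are polynomials in [y]. *)
Definition pev (y : R) (p : list Z) : R := gev IZR y p.
Definition qev (x y : R) (p : list (list Z)) : R := gev (pev y) x p.

Definition padd := gadd Z.add.
Definition pmul := gmul 0%Z Z.add Z.mul.
Definition pscal (c : Z) := map (Z.mul c).
Definition qadd := gadd padd.
Definition qmul := gmul [] padd pmul.
Definition qscal (c : Z) := map (pscal c).
Definition qder := gder [] padd.
Definition qsum (p : list (list Z)) := fold_right padd [] p.

Lemma pev_add y p q : pev y (padd p q) = pev y p + pev y q.
Proof. apply gev_add; intros; apply plus_IZR. Qed.

Lemma pev_mul y p q : pev y (pmul p q) = pev y p * pev y q.
Proof.
apply gev_mul; [reflexivity|intros; apply plus_IZR|intros; apply mult_IZR].
Qed.

Lemma pev_scal y c p : pev y (pscal c p) = IZR c * pev y p.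
Proof. apply gev_map; intros; apply mult_IZR. Qed.

Lemma qev_add x y p q : qev x y (qadd p q) = qev x y p + qev x y q.
Proof. apply gev_add; intros; apply pev_add. Qed.

Lemma qev_mul x y p q : qev x y (qmul p q) = qev x y p * qev x y q.
Proof.
apply gev_mul; [reflexivity|intros; apply pev_add|intros; apply pev_mul].
Qed.

Lemma qev_scal x y c p : qev x y (qscal c p) = IZR c * qev x y p.
Proof. apply gev_map; intros; apply pev_scal. Qed.

Lemma is_derive_qev y p x : is_derive (fun t => qev t y p) x (qev x y (qder p)).
Proof. apply is_derive_gev; [reflexivity|intros; apply pev_add]. Qed.

Lemma pev_qsum y p : pev y (qsum p) = qev 1 y p.
Proof.
induction p as [|c p IH]; [reflexivity|].
change (pev y (padd c (qsum p)) = pev y c + 1 * qev 1 y p).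
rewrite pev_add, IH; ring.
Qed.

Lemma pev_cons y c p : pev y (c :: p) = IZR c + y * pev y p.
Proof. reflexivity. Qed.

Lemma qev_cons x y c p : qev x y (c :: p) = pev y c + x * qev x y p.
Proof. reflexivity. Qed.

Lemma qev_start y c p : qev 0 y (c :: p) = pev y c.
Proof. rewrite qev_cons; ring. Qed.

Lemma qev_qder_start y c c' p : qev 0 y (qder (c :: c' :: p)) = pev y c'.
Proof.
change (qev 0 y (qadd (c' :: p) ([] :: qder (c' :: p))) = pev y c').
rewrite qev_add, !qev_start; unfold pev; simpl; ring.
Qed.

(* Upper bounds for [Rabs y <= 1] and, where [x] occurs, [0 <= x <= 1]. *)
Definition abssum (p : list Z) : Z := fold_right (fun c s => Z.abs c + s)%Z 0%Z p.
Definition pub (p : list Z) : Z :=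
  match p with [] => 0%Z | c :: p' => (c + abssum p')%Z end.
(** A Horner scheme on bounds: a negative coefficient absorbs positive ones of higher degree in [x],
    which makes this sharper than a sum of absolute values. *)
Fixpoint qub (p : list (list Z)) : Z :=
  match p with [] => 0%Z | c :: p' => (pub c + Z.max 0 (qub p'))%Z end.
Definition qabs (p : list (list Z)) : Z := Z.max (qub p) (qub (qscal (-1) p)).

Lemma pev_abssum y p : Rabs y <= 1 -> Rabs (pev y p) <= IZR (abssum p).
Proof.
intros Hy; induction p as [|c p IH].
- unfold pev; simpl; rewrite Rabs_R0; lra.
- change (Rabs (IZR c + y * pev y p) <= IZR (Z.abs c + abssum p)).
  rewrite plus_IZR, abs_IZR.
  apply Rle_trans with (1 := Rabs_triang _ _).
  rewrite Rabs_mult.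
  assert (H := Rabs_pos (pev y p)); nra.
Qed.

Lemma pev_pub y p : Rabs y <= 1 -> pev y p <= IZR (pub p).
Proof.
intros Hy; destruct p as [|c p]; [unfold pev; simpl; lra|].
change (IZR c + y * pev y p <= IZR (c + abssum p)).
rewrite plus_IZR.
assert (H := pev_abssum y p Hy).
assert (H' := Rle_abs (y * pev y p)); rewrite Rabs_mult in H'.
assert (H2 := Rabs_pos (pev y p)); nra.
Qed.

Lemma qev_qub x y p : 0 <= x <= 1 -> Rabs y <= 1 -> qev x y p <= IZR (qub p).
Proof.
intros Hx Hy; induction p as [|c p IH]; [unfold qev; simpl; lra|].
change (pev y c + x * qev x y p <= IZR (pub c + Z.max 0 (qub p))).
rewrite plus_IZR.
assert (H := pev_pub y c Hy).
assert (H1 : IZR (qub p) <= IZR (Z.max 0 (qub p))) by (apply IZR_le; lia).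
assert (H2 : 0 <= IZR (Z.max 0 (qub p))) by (apply (IZR_le 0); lia).
nra.
Qed.

Lemma qev_qabs x y p : 0 <= x <= 1 -> Rabs y <= 1 ->
  Rabs (qev x y p) <= IZR (qabs p).
Proof.
intros Hx Hy; apply Rabs_le; split.
- assert (H := qev_qub x y (qscal (-1) p) Hx Hy); rewrite qev_scal in H.
  assert (H1 : IZR (qub (qscal (-1) p)) <= IZR (qabs p))
    by (apply IZR_le; unfold qabs; lia).
  lra.
- apply Rle_trans with (1 := qev_qub x y p Hx Hy).
  apply IZR_le; unfold qabs; lia.
Qed.

Lemma qev_qlb x y p : 0 <= x <= 1 -> Rabs y <= 1 ->
  - IZR (qub (qscal (-1) p)) <= qev x y p.
Proof.
intros Hx Hy.
assert (H := qev_qub x y (qscal (-1) p) Hx Hy); rewrite qev_scal in H; lra.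
Qed.

Lemma pev_plb y p : Rabs y <= 1 -> - IZR (pub (pscal (-1) p)) <= pev y p.
Proof.
intros Hy; assert (H := pev_pub y (pscal (-1) p) Hy).
rewrite pev_scal in H; lra.
Qed.

(** * Differential inequalities *)

Lemma mean_value (f f' : R -> R) (a b : R) :
  a < b ->
  (forall x, a <= x <= b -> continuity_pt f x) ->
  (forall x, a < x < b -> is_derive f x (f' x)) ->
  exists c, a < c < b /\ f b - f a = f' c * (b - a).
Proof.
intros Hlt Hc Hd.
pose (pr := fun c (Hx : a < c < b) =>
  exist (derivable_pt_lim f c) (f' c)
    (proj1 (is_derive_Reals f c (f' c)) (Hd c Hx)) : derivable_pt f c).
destruct (MVT f id a b pr (fun c _ => derivable_pt_id c) Hlt Hc) as [c [H1 H2]].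
{ intros; apply derivable_continuous_pt, derivable_pt_id. }
exists c; split; [exact H1|].
rewrite derive_pt_id in H2.
replace (derive_pt f c (pr c H1)) with (f' c) in H2 by reflexivity.
unfold id in H2; lra.
Qed.

Lemma nonincreasing_le (f f' : R -> R) (a b : R) :
  a <= b ->
  (forall x, a <= x <= b -> continuity_pt f x) ->
  (forall x, a < x < b -> is_derive f x (f' x)) ->
  (forall x, a < x < b -> f' x <= 0) ->
  f b <= f a.
Proof.
intros Hab Hc Hd Hn.
destruct (Req_dec a b) as [->|Hne]; [lra|].
destruct (mean_value f f' a b ltac:(lra) Hc Hd) as [c [H1 H2]].
specialize (Hn c H1); nra.
Qed.

Lemma increasing_lt (f f' : R -> R) (a b : R) :
  a < b ->
  (forall x, a <= x <= b -> continuity_pt f x) ->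
  (forall x, a < x < b -> is_derive f x (f' x)) ->
  (forall x, a < x < b -> 0 < f' x) ->
  f a < f b.
Proof.
intros Hlt Hc Hd Hn.
destruct (mean_value f f' a b Hlt Hc Hd) as [c [H1 H2]].
specialize (Hn c H1); nra.
Qed.

Lemma is_derive_continuity_pt (f : R -> R) x l : is_derive f x l -> continuity_pt f x.
Proof.
intros H; apply derivable_continuous_pt.
exists l; now apply is_derive_Reals.
Qed.

Lemma exp_le (x y : R) : x <= y -> exp x <= exp y.
Proof. intros [H| ->]; [left; now apply exp_increasing|right; reflexivity]. Qed.

Lemma is_derive_ext_pos (f g : R -> R) (x l : R) :
  0 < x -> (forall y, 0 < y -> f y = g y) -> is_derive f x l -> is_derive g x l.
Proof.
intros Hx Hfg; apply is_derive_ext_loc.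
exists (mkposreal x Hx); intros y Hy; apply Hfg.
change (Rabs (y - x) < x) in Hy.
apply Rabs_lt_between in Hy; lra.
Qed.

Ltac rewrite_derive H :=
  match type of H with
  | is_derive ?f ?x ?l =>
    let E := fresh in
    assert (E : Derive (fun t : R => f t) x = l) by exact (is_derive_unique f x l H);
    rewrite E; clear E
  end.

(** For [E = lam^2 y^2 + z^2] the weight [lam] balances the cross term, [4 lam^2 |y z| <= 2 lam E],
    and the source costs [2 z s <= z^2 / 8 + 8 s^2]. Hence [E' <= (2 lam + 1/8) E + 8 sg^2]. *)
Lemma gronwall_cell (y z k s : R -> R) (a b lam sg e : R) :
  0 < lam -> a <= b <= a + 1 -> 0 <= e ->
  (forall x, a <= x <= b -> continuity_pt y x) ->
  (forall x, a <= x <= b -> continuity_pt z x) ->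
  (forall x, a < x < b -> is_derive y x (z x)) ->
  (forall x, a < x < b -> is_derive z x (k x * y x + s x)) ->
  (forall x, a < x < b -> Rabs (k x) <= lam ^ 2) ->
  (forall x, a < x < b -> Rabs (s x) <= sg) ->
  lam ^ 2 * y a ^ 2 + z a ^ 2 <= e ->
  lam ^ 2 * y b ^ 2 + z b ^ 2 <= exp (2 * lam + 1 / 8) * (e + 8 * sg ^ 2).
Proof.
intros Hlam Hab He Hcy Hcz Hy Hz Hk Hs H0.
set (c := 2 * lam + 1 / 8).
set (E := fun x => lam ^ 2 * y x ^ 2 + z x ^ 2).
set (E' := fun x => lam ^ 2 * (2 * y x * z x) + 2 * z x * (k x * y x + s x)).
assert (HE' : forall x, a < x < b -> E' x <= c * E x + 8 * sg ^ 2).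
{ intros x Hx; unfold E', E, c.
  specialize (Hk x Hx); specialize (Hs x Hx).
  assert (H1 : 2 * (lam ^ 2 + k x) * (y x * z x) <= 4 * lam ^ 2 * (Rabs (y x) * Rabs (z x))).
  { rewrite <- Rabs_mult.
    assert (A1 := Rle_abs (2 * (lam ^ 2 + k x) * (y x * z x))).
    rewrite Rabs_mult in A1.
    assert (A2 : Rabs (2 * (lam ^ 2 + k x)) <= 4 * lam ^ 2).
    { apply Rabs_le; apply Rabs_le_between in Hk; split; nra. }
    assert (A3 := Rabs_pos (y x * z x)); nra. }
  assert (H2 : 4 * lam ^ 2 * (Rabs (y x) * Rabs (z x)) <= 2 * lam * (lam ^ 2 * y x ^ 2 + z x ^ 2)).
  { rewrite <- (pow2_abs (y x)), <- (pow2_abs (z x)).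
    assert (A := pow2_ge_0 (lam * Rabs (y x) - Rabs (z x))); nra. }
  assert (H3 : 2 * z x * s x <= 1 / 8 * z x ^ 2 + 8 * sg ^ 2).
  { assert (A1 := pow2_ge_0 (z x - 8 * s x)).
    assert (A2 : s x ^ 2 <= sg ^ 2).
    { rewrite <- (pow2_abs (s x)); assert (A3 := Rabs_pos (s x)); nra. }
    nra. }
  assert (0 <= lam ^ 2 * y x ^ 2) by (rewrite <- Rpow_mult_distr; apply pow2_ge_0).
  nra. }
assert (HEd : forall x, a < x < b -> is_derive E x (E' x)).
{ intros x Hx; unfold E, E'.
  specialize (Hy x Hx); specialize (Hz x Hx).
  auto_derive.
  - repeat split; [exact (ex_intro _ _ Hy)|exact (ex_intro _ _ Hz)].
  - rewrite_derive Hy; rewrite_derive Hz; ring. }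
assert (HEc : forall x, a <= x <= b -> continuity_pt E x).
{ intros x Hx; unfold E.
  apply continuity_pt_plus.
  - apply (continuity_pt_mult (fun _ => lam ^ 2) (fun x => y x ^ 2)).
    + apply continuity_pt_const; intros ? ?; reflexivity.
    + apply (continuity_pt_comp y (fun u => u ^ 2)); [now apply Hcy|].
      apply derivable_continuous_pt, derivable_pt_pow.
  - apply (continuity_pt_comp z (fun u => u ^ 2)); [now apply Hcz|].
    apply derivable_continuous_pt, derivable_pt_pow. }
set (B := 8 * sg ^ 2) in *.
assert (HB : 0 <= B) by (unfold B; assert (A := pow2_ge_0 sg); lra).
assert (Hc : 0 < c) by (unfold c; lra).
(* The term [B * (x - a)] absorbs the source; on a cell of length at most 1 it contributes at most
   [B]. *)
assert (Hm := nonincreasing_le (fun x => exp (- c * (x - a)) * E x - B * (x - a))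
  (fun x => exp (- c * (x - a)) * (E' x - c * E x) - B) a b (proj1 Hab)).
cbv beta in Hm.
assert (Hfin : exp (- c * (b - a)) * E b - B * (b - a) <=
  exp (- c * (a - a)) * E a - B * (a - a)).
{ apply Hm.
  - intros x Hx.
    apply (continuity_pt_minus (fun x => exp (- c * (x - a)) * E x) (fun x => B * (x - a))).
    + apply (continuity_pt_mult (fun x => exp (- c * (x - a))) E); [|now apply HEc].
      apply (is_derive_continuity_pt _ _ (- c * exp (- c * (x - a)))).
      auto_derive; [trivial|ring_simplify; reflexivity].
    + apply (is_derive_continuity_pt _ _ B); auto_derive; [trivial|ring].
  - intros x Hx; specialize (HEd x Hx).
    auto_derive; [exact (ex_intro _ _ HEd)|].
    rewrite_derive HEd; unfold Rminus; ring.
  - intros x Hx.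
    assert (A1 : 0 < exp (- c * (x - a)) <= 1).
    { split; [apply exp_pos|].
      rewrite <- exp_0; apply exp_le; nra. }
    specialize (HE' x Hx); fold B in HE'; nra. }
replace (- c * (a - a)) with 0 in Hfin by ring.
rewrite exp_0 in Hfin.
change (E b <= exp c * (e + B)).
change (E a <= e) in H0.
assert (Hx1 : exp (- c * (b - a)) * E b <= e + B) by nra.
assert (Hx2 : E b = exp (c * (b - a)) * (exp (- c * (b - a)) * E b)).
{ rewrite <- Rmult_assoc, <- exp_plus.
  replace (c * (b - a) + - c * (b - a)) with 0 by ring; rewrite exp_0; ring. }
rewrite Hx2.
assert (Hx3 : exp (c * (b - a)) <= exp c) by (apply exp_le; nra).
assert (Hx4 := exp_pos (c * (b - a))).
apply Rle_trans with (exp (c * (b - a)) * (e + B)); nra.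
Qed.

(** From [exp (-1/8) >= 1 - 1/8]. With [lam = l / 16] the Gronwall exponent is [(l + 1) / 8], so its
    factor is bounded by a rational power. *)
Lemma exp_eighths (n : nat) : exp (INR n / 8) <= (8 / 7) ^ n.
Proof.
induction n as [|n IH]; [simpl; rewrite Rdiv_0_l, exp_0; lra|].
rewrite S_INR.
replace ((INR n + 1) / 8) with (INR n / 8 + 1 / 8) by field.
rewrite exp_plus, <- tech_pow_Rmult, Rmult_comm.
assert (H : exp (1 / 8) <= 8 / 7).
{ assert (A := exp_ineq1_le (- (1 / 8))).
  rewrite exp_Ropp in A.
  assert (A1 := exp_pos (1 / 8)).
  assert (A2 : / exp (1 / 8) * exp (1 / 8) = 1) by (field; lra).
  nra. }
assert (H1 := exp_pos (1 / 8)); assert (H2 := exp_pos (INR n / 8)).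
nra.
Qed.

(** The equations hold only for [x > 0], while the mean value theorem and Gronwall's inequality need
    continuity at 0. A bounded second derivative makes [h1] Lipschitz near 0, so its right limit is
    that of the difference quotients of [h], namely [l]. *)
Lemma derivative_right_continuous (h h1 k : R -> R) (l : R) :
  is_derive h 0 l ->
  (forall x, 0 < x -> is_derive h x (h1 x)) ->
  (forall x, 0 < x -> is_derive h1 x (k x)) ->
  continuity_pt k 0 ->
  continuity_pt (fun x => if Rle_dec x 0 then l else h1 x) 0.
Proof.
intros Hl Hh Hh1 Hk.
assert (Hb : exists d M, 0 < d /\ 0 < M /\ forall x, 0 < x < d -> Rabs (k x) <= M).
{ destruct (Hk 1) as [d [Hd H]]; [lra|].
  exists d, (Rabs (k 0) + 1); split; [exact Hd|]; split.
  - assert (A := Rabs_pos (k 0)); lra.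
  - intros x Hx.
    assert (A : Rabs (k x - k 0) < 1).
    { apply (H x); split; [split; [exact I|lra]|].
      simpl; unfold Rdist; rewrite Rabs_right; lra. }
    replace (k x) with (k 0 + (k x - k 0)) by ring.
    apply Rle_trans with (1 := Rabs_triang _ _); lra. }
destruct Hb as [d [M [Hd [HM Hb]]]].
(* Comparing [h1 y] with the difference quotient of [h] on [0, y]. *)
assert (Hq : forall y, 0 < y < d -> Rabs (h1 y - (h y - h 0) / y) <= M * y).
{ intros y Hy.
  destruct (mean_value h h1 0 y (proj1 Hy)) as [c [H1 H2]].
  { intros c Hc; destruct (Req_dec c 0) as [->|Hne].
    - exact (is_derive_continuity_pt _ _ _ Hl).
    - apply (is_derive_continuity_pt h c (h1 c)), Hh; lra. }
  { intros c Hc; apply Hh; lra. }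
  replace ((h y - h 0) / y) with (h1 c) by (field_simplify_eq; lra).
  destruct (MVT_gen h1 c y k) as [e [H3 H4]].
  - intros x Hx; apply Hh1.
    rewrite Rmin_left in Hx; lra.
  - intros x Hx; apply (is_derive_continuity_pt h1 x (k x)), Hh1.
    rewrite Rmin_left in Hx; lra.
  - rewrite Rmin_left, Rmax_right in H3 by lra.
    rewrite H4, Rabs_mult.
    assert (A := Hb e ltac:(lra)).
    rewrite (Rabs_right (y - c)) by lra.
    assert (A1 := Rabs_pos (k e)); nra. }
intros eps Heps.
destruct (proj1 (is_derive_Reals h 0 l) Hl (eps / 2) ltac:(lra)) as [d' Hd'].
exists (Rmin (Rmin d d') (eps / (2 * M))).
assert (Hq1 : 0 < eps / (2 * M)) by (apply Rdiv_lt_0_compat; lra).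
split.
{ apply Rmin_glb_lt; [apply Rmin_glb_lt; [exact Hd|apply cond_pos]|exact Hq1]. }
intros x [[_ Hx0] Hx].
simpl in Hx |- *; unfold Rdist in *.
destruct (Rle_dec 0 0) as [_|Hn]; [|lra].
destruct (Rle_dec x 0) as [Hneg|Hpos].
{ rewrite Rminus_diag, Rabs_R0; exact Heps. }
rewrite Rminus_0_r, Rabs_right in Hx by lra.
assert (Hx1 : x < d /\ x < d' /\ x < eps / (2 * M)).
{ repeat split; eapply Rlt_le_trans; try exact Hx.
  - apply Rle_trans with (1 := Rmin_l _ _), Rmin_l.
  - apply Rle_trans with (1 := Rmin_l _ _), Rmin_r.
  - apply Rmin_r. }
destruct Hx1 as [Hx1 [Hx2 Hx3]].
assert (A1 := Hq x ltac:(lra)).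
assert (A2 := Hd' x ltac:(lra)).
rewrite Rabs_right in A2 by lra.
specialize (A2 Hx2); rewrite Rplus_0_l in A2.
assert (A3 : M * x < eps / 2).
{ replace (eps / 2) with (M * (eps / (2 * M))) by (field; lra).
  apply Rmult_lt_compat_l; assumption. }
replace (h1 x - l) with ((h1 x - (h x - h 0) / x) + ((h x - h 0) / x - l)) by ring.
apply Rle_lt_trans with (1 := Rabs_triang _ _); lra.
Qed.

Lemma first_zero (f : R -> R) (a b : R) :
  a <= b -> (forall x, a <= x <= b -> continuity_pt f x) -> f a < 0 -> 0 <= f b ->
  exists c, a < c <= b /\ f c = 0 /\ forall x, a <= x < c -> f x < 0.
Proof.
intros Hab Hc Ha Hb.
set (S := fun x => a <= x <= b /\ forall y, a <= y <= x -> f y < 0).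
destruct (completeness S) as [c [Hub Hlub]].
- exists b; intros x [Hx _]; lra.
- exists a; split; [lra|]; intros y Hy; replace y with a by lra; exact Ha.
- assert (Hac : a <= c).
  { apply Hub; split; [lra|]; intros y Hy; replace y with a by lra; exact Ha. }
  assert (Hcb : c <= b) by (apply Hlub; intros x [Hx _]; lra).
  assert (Hlt : forall x, a <= x < c -> f x < 0).
  { intros x Hx; apply NNPP; intros Hn.
    assert (c <= x); [|lra].
    apply Hlub; intros y [Hy1 Hy2]; apply Rnot_lt_le; intros Hy.
    apply Hn, Hy2; lra. }
  assert (Hle : f c <= 0).
  { apply Rnot_lt_le; intros Hpos.
    destruct (Hc c (conj Hac Hcb) (f c) Hpos) as [d [Hd H]].
    assert (Hne : a <> c) by (intros E; rewrite <- E in Hpos; lra).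
    set (x := Rmax a (c - d / 2)).
    assert (Hx : a <= x < c /\ c - x < d).
    { unfold x; assert (A1 := Rmax_l a (c - d / 2)).
      assert (A2 := Rmax_r a (c - d / 2)).
      repeat split; [exact A1| |lra].
      apply Rmax_lub_lt; lra. }
    assert (A := H x); simpl in A; unfold Rdist in A.
    assert (A' : Rabs (f x - f c) < f c).
    { apply A; split; [split; [exact I|lra]|].
      rewrite Rabs_left; lra. }
    apply Rabs_lt_between in A'.
    specialize (Hlt x (proj1 Hx)); lra. }
  assert (Hge : 0 <= f c).
  { apply Rnot_lt_le; intros Hneg.
    destruct (Hc c (conj Hac Hcb) (- f c)) as [d [Hd H]]; [lra|].
    assert (Hne : c <> b) by (intros E; rewrite E in Hneg; lra).
    set (x := Rmin b (c + d / 2)).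
    assert (Hx : c < x <= b /\ x - c < d).
    { unfold x; assert (A1 := Rmin_l b (c + d / 2)).
      assert (A2 := Rmin_r b (c + d / 2)).
      repeat split; [apply Rmin_glb_lt; lra|lra|lra]. }
    assert (x <= c); [|lra].
    apply Hub; split; [lra|]; intros y Hy.
    destruct (Rlt_dec y c) as [Hyc|Hyc]; [apply Hlt; lra|].
    destruct (Req_dec y c) as [->|Hyne]; [exact Hneg|].
    assert (A := H y); simpl in A; unfold Rdist in A.
    assert (A' : Rabs (f y - f c) < - f c).
    { apply A; split; [split; [exact I|lra]|].
      rewrite Rabs_right; lra. }
    apply Rabs_lt_between in A'; lra. }
  exists c; repeat split; [|exact Hcb|lra|exact Hlt].
  destruct (Req_dec a c) as [E|]; [rewrite <- E in Hge|]; lra.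
Qed.

(** * Scaled ground states *)

(* [w x = al * Q (al * x / 2)] with [al = 1 / Q 0]: the scaling makes the
   initial value 1 and leaves [al] as a parameter of the equation. *)
Definition profile (al : R) (w : R -> R) : Prop :=
  0 < al /\ w 0 = 1 /\
  (forall x, 0 <= x -> 0 < w x) /\
  (forall x, ex_derive w x) /\
  (forall x, 0 < x ->
     is_derive (Derive w) x (- (2 / x) * Derive w x + (al ^ 2 * w x - w x ^ 3) / 4)) /\
  is_lim w p_infty 0.

(* The derivative of [x * w x]; nothing is known about [Derive w] to the left
   of the origin, hence the case distinction. *)
Definition flux (w : R -> R) (x : R) : R :=
  if Rle_dec x 0 then w 0 else w x + x * Derive w x.

Section Profile.
Variables (al : R) (w : R -> R).
Hypothesis Hw : profile al w.

Let al_pos : 0 < al := proj1 Hw.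
Let w0 : w 0 = 1 := proj1 (proj2 Hw).
Let w_pos : forall x, 0 <= x -> 0 < w x := proj1 (proj2 (proj2 Hw)).
Let w_der : forall x, ex_derive w x := proj1 (proj2 (proj2 (proj2 Hw))).
Let w_ode := proj1 (proj2 (proj2 (proj2 (proj2 Hw)))).
Let w_lim : is_lim w p_infty 0 := proj2 (proj2 (proj2 (proj2 (proj2 Hw)))).

Lemma flux_pos x : 0 < x -> flux w x = w x + x * Derive w x.
Proof. intros H; unfold flux; destruct (Rle_dec x 0); [lra|reflexivity]. Qed.

Lemma flux_0 : flux w 0 = 1.
Proof. unfold flux; destruct (Rle_dec 0 0); [exact w0|lra]. Qed.

Lemma profile_is_derive x : is_derive w x (Derive w x).
Proof. apply Derive_correct, w_der. Qed.

Lemma profile_continuity x : continuity_pt w x.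
Proof. exact (is_derive_continuity_pt _ _ _ (profile_is_derive x)). Qed.

Lemma is_derive_moment x : 0 < x -> is_derive (fun t => t * w t) x (flux w x).
Proof.
intros Hx; rewrite flux_pos by assumption.
auto_derive; [apply w_der|].
change (Derive (fun t => w t) x) with (Derive w x); ring.
Qed.

Lemma is_derive_flux x : 0 < x ->
  is_derive (flux w) x (x * (al ^ 2 * w x - w x ^ 3) / 4).
Proof.
intros Hx.
apply (is_derive_ext_pos (fun t => w t + t * Derive w t)); [exact Hx| |].
- intros t Ht; symmetry; now apply flux_pos.
- assert (H := w_ode x Hx).
  auto_derive.
  + repeat split; [apply w_der|exact (ex_intro _ _ H)].
  + rewrite_derive H.
    change (Derive (fun t => w t) x) with (Derive w x); field; lra.
Qed.

Lemma flux_continuity x : 0 <= x -> continuity_pt (flux w) x.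
Proof.
intros Hx; destruct (Req_dec x 0) as [->|Hne].
- assert (H := derivative_right_continuous (fun t => t * w t)
    (fun t => w t + t * Derive w t) (fun t => t * (al ^ 2 * w t - w t ^ 3) / 4) (w 0)).
  apply H.
  + auto_derive; [apply w_der|].
    change (Derive (fun t => w t) 0) with (Derive w 0); ring.
  + intros y Hy; rewrite <- flux_pos by assumption; now apply is_derive_moment.
  + intros y Hy.
    apply (is_derive_ext_pos (flux w)); [exact Hy|exact flux_pos|now apply is_derive_flux].
  + assert (A := w_der 0).
    apply derivable_continuous_pt, ex_derive_Reals_0.
    auto_derive; repeat split; apply w_der.
- apply (is_derive_continuity_pt _ _ _ (is_derive_flux x ltac:(lra))).
Qed.

(* For [x > 0] this is [x^2 * w' x]. *)
Let slope (x : R) : R := x * flux w x - x * w x.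

Lemma slope_continuity x : 0 <= x -> continuity_pt slope x.
Proof.
intros Hx; unfold slope.
apply (continuity_pt_minus (fun x => x * flux w x) (fun x => x * w x)).
- apply (continuity_pt_mult (fun x => x) (flux w));
    [apply derivable_continuous_pt, derivable_pt_id|now apply flux_continuity].
- apply (continuity_pt_mult (fun x => x) w);
    [apply derivable_continuous_pt, derivable_pt_id|apply profile_continuity].
Qed.

Lemma is_derive_slope x : 0 < x ->
  is_derive slope x (x ^ 2 * (al ^ 2 * w x - w x ^ 3) / 4).
Proof.
intros Hx; unfold slope.
assert (H := is_derive_flux x Hx).
auto_derive.
- repeat split; [exact (ex_intro _ _ H)|apply w_der].
- rewrite_derive H; rewrite flux_pos by assumption.
  change (Derive (fun t => w t) x) with (Derive w x); field.
Qed.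

Lemma slope_eq x : 0 < x -> slope x = x ^ 2 * Derive w x.
Proof. intros Hx; unfold slope; rewrite flux_pos by assumption; ring. Qed.

Lemma slope_0 : slope 0 = 0.
Proof. unfold slope; ring. Qed.

Lemma profile_eventually_small (eps : R) : 0 < eps ->
  exists M, forall x, M < x -> 0 <= x -> w x < eps.
Proof.
intros He.
destruct (proj2 (is_lim_spec _ _ _) w_lim (mkposreal eps He)) as [M HM].
exists M; intros x Hx H0; specialize (HM x Hx); simpl in HM.
apply Rabs_lt_between in HM; lra.
Qed.

(** The equation is that of a point moving in the potential [(w^4 / 4 - al^2 w^2 / 2) / 4] under
    friction [2 / x]. *)
Let energy (x : R) : R := Derive w x ^ 2 / 2 + (w x ^ 4 / 4 - al ^ 2 * w x ^ 2 / 2) / 4.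

(** Friction makes the energy nonincreasing. As [w] tends to 0 so does the potential, and the
    kinetic part is nonnegative: a negative energy could not persist. *)
Lemma energy_nonneg x : 0 < x -> 0 <= energy x.
Proof.
intros Hx; apply Rnot_lt_le; intros Hneg.
assert (Hmon : forall y, x <= y -> energy y <= energy x).
{ intros y Hy.
  assert (Hd : forall t, x <= t <= y -> is_derive energy t (- (2 / t) * Derive w t ^ 2)).
  { intros t Ht; unfold energy.
    assert (H := w_ode t ltac:(lra)).
    auto_derive.
    - repeat split; first [exact (ex_intro _ _ H)|apply w_der].
    - rewrite_derive H.
      change (Derive (fun t => w t) t) with (Derive w t); field; lra. }
  apply (nonincreasing_le energy (fun t => - (2 / t) * Derive w t ^ 2)); [exact Hy| | |].
  - intros t Ht; exact (is_derive_continuity_pt _ _ _ (Hd t Ht)).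
  - intros t Ht; apply Hd; lra.
  - intros t Ht; assert (A := pow2_ge_0 (Derive w t)).
    assert (0 < 2 / t) by (apply Rdiv_lt_0_compat; lra); nra. }
set (eta := - energy x) in *.
assert (Heta : 0 < eta) by (unfold eta; lra).
assert (He : 0 < Rmin 1 (eta / al ^ 2)).
{ apply Rmin_glb_lt; [lra|apply Rdiv_lt_0_compat; nra]. }
destruct (profile_eventually_small _ He) as [M HM].
set (y := Rmax x (M + 1)).
assert (Hy1 : x <= y) by apply Rmax_l.
assert (Hy2 : M + 1 <= y) by apply Rmax_r.
specialize (HM y ltac:(lra) ltac:(lra)).
assert (Hwy := w_pos y ltac:(lra)).
assert (A1 := Rmin_l 1 (eta / al ^ 2)); assert (A2 := Rmin_r 1 (eta / al ^ 2)).
assert (A3 : al ^ 2 * w y <= eta).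
{ replace eta with (al ^ 2 * (eta / al ^ 2)) by (field; lra).
  apply Rmult_le_compat_l; [nra|lra]. }
specialize (Hmon y Hy1).
assert (Hey : energy y =
  Derive w y ^ 2 / 2 + (w y ^ 4 / 4 - al ^ 2 * w y ^ 2 / 2) / 4) by reflexivity.
assert (A4 := pow2_ge_0 (Derive w y)).
assert (A5 : 0 <= w y ^ 4) by (apply pow_le; lra).
assert (A6 : al ^ 2 * w y ^ 2 <= eta) by nra.
assert (A7 : energy x = - eta) by (unfold eta; ring).
lra.
Qed.

(** The energy tends to [(1/4 - al^2 / 2) / 4] at the origin and is nonnegative. That [w'] tends to
    0 there has to be derived from the equation, through [slope]. *)
Lemma profile_al_le : al ^ 2 <= 1 / 2.
Proof.
apply Rnot_lt_le; intros Hal.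
assert (Hkc : continuity_pt (fun x => (al ^ 2 * w x - w x ^ 3) / 4) 0).
{ apply derivable_continuous_pt, ex_derive_Reals_0.
  auto_derive; repeat split; apply w_der. }
destruct (Hkc 1) as [d [Hd HM]]; [lra|].
set (M := al ^ 2 + 2).
assert (HM' : forall x, 0 < x < d -> Rabs ((al ^ 2 * w x - w x ^ 3) / 4) <= M).
{ intros x Hx.
  assert (A := HM x); simpl in A; unfold Rdist in A.
  rewrite w0 in A.
  assert (A' : Rabs ((al ^ 2 * w x - w x * (w x * (w x * 1))) / 4
     - (al ^ 2 * 1 - 1 * (1 * (1 * 1))) / 4) < 1).
  { apply A; split; [split; [exact I|lra]|].
    rewrite Rabs_right; lra. }
  apply Rabs_lt_between in A'; apply Rabs_le; unfold M; split; simpl in *; nra. }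
assert (Hder : forall x, 0 < x < d -> Derive w x ^ 2 <= M ^ 2 * x ^ 2).
{ intros x Hx.
  (* The derivative of [slope] is at most [M * t ^ 2] in absolute value, which gives [|w'| <= M x];
     [e] stands for a sign. *)
  assert (Hs : forall e, e ^ 2 = 1 -> e * slope x <= M * x ^ 3).
  { intros e He.
    assert (A := nonincreasing_le (fun t => e * slope t - M * t ^ 3)
      (fun t => e * (t ^ 2 * (al ^ 2 * w t - w t ^ 3) / 4) - 3 * M * t ^ 2) 0 x ltac:(lra)).
    cbv beta in A; rewrite slope_0 in A.
    assert (e * slope x - M * x ^ 3 <= e * 0 - M * 0 ^ 3); [|simpl in *; lra].
    apply A.
    - intros t Ht.
      apply (continuity_pt_minus (fun t => e * slope t) (fun t => M * t ^ 3)).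
      + apply (continuity_pt_mult (fun _ => e) slope).
        * apply continuity_pt_const; intros ? ?; reflexivity.
        * apply slope_continuity; lra.
      + apply derivable_continuous_pt, ex_derive_Reals_0; auto_derive; trivial.
    - intros t Ht; assert (B := is_derive_slope t ltac:(lra)).
      auto_derive; [exact (ex_intro _ _ B)|].
      rewrite_derive B; field.
    - intros t Ht; assert (B := HM' t ltac:(lra)).
      assert (B1 : e * ((al ^ 2 * w t - w t ^ 3) / 4) <= M).
      { apply Rle_trans with (1 := Rle_abs _); rewrite Rabs_mult.
        replace (Rabs e) with 1; [lra|].
        assert (E : Rabs e ^ 2 = 1) by (rewrite pow2_abs; exact He).
        assert (E1 := Rabs_pos e); nra. }
      assert (B2 := pow2_ge_0 t).
      assert (B3 : 0 <= M) by (unfold M; nra).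
      nra. }
  assert (H1 := Hs 1 ltac:(lra)); assert (H2 := Hs (-1) ltac:(lra)).
  rewrite slope_eq in H1, H2 by lra.
  assert (Hx2 : 0 < x ^ 2) by (apply pow_lt; lra).
  assert (H3 : Derive w x <= M * x) by nra.
  assert (H4 : - Derive w x <= M * x) by nra.
  nra. }
set (g := fun x => M ^ 2 * x ^ 2 / 2 + (w x ^ 4 / 4 - al ^ 2 * w x ^ 2 / 2) / 4).
assert (Hg : continuity_pt g 0).
{ apply derivable_continuous_pt, ex_derive_Reals_0; unfold g.
  auto_derive; repeat split; apply w_der. }
assert (Hg0 : g 0 < 0) by (unfold g; rewrite w0; nra).
destruct (Hg (- g 0)) as [d' [Hd' Hg']]; [lra|].
set (x := Rmin d d' / 2).
assert (Hx : 0 < x /\ x < d /\ x < d').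
{ unfold x; assert (A1 := Rmin_l d d'); assert (A2 := Rmin_r d d').
  assert (A3 : 0 < Rmin d d') by (apply Rmin_glb_lt; lra); lra. }
assert (A := Hg' x); simpl in A; unfold Rdist in A.
assert (A' : Rabs (g x - g 0) < - g 0).
{ apply A; split; [split; [exact I|lra]|]; rewrite Rabs_right; lra. }
apply Rabs_lt_between in A'.
assert (B := energy_nonneg x (proj1 Hx)); unfold energy in B.
assert (B1 := Hder x ltac:(lra)).
unfold g in A'; nra.
Qed.

(** At a first critical point [c] the energy is purely potential and nonnegative, so
    [w c ^ 2 >= 2 al^2]. Then [w > al] on all of [(0, c]], where [slope] decreases strictly from 0
    and cannot vanish at [c]. *)
Lemma profile_derive_neg x : 0 < x -> Derive w x < 0.
Proof.
intros Hx; apply Rnot_le_lt; intros Hpos.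
assert (Hal := profile_al_le).
(* While [w > al] the slope decreases strictly, so it is negative near 0. *)
assert (Hnear : exists d, 0 < d < x /\ forall y, 0 <= y <= d -> al < w y).
{ destruct (profile_continuity 0 (1 - al)) as [d [Hd H]]; [nra|].
  exists (Rmin d x / 2).
  assert (A1 := Rmin_l d x); assert (A2 := Rmin_r d x).
  assert (A3 : 0 < Rmin d x) by (apply Rmin_glb_lt; lra).
  split; [lra|]; intros y Hy.
  destruct (Req_dec y 0) as [->|Hne]; [rewrite w0; nra|].
  assert (A := H y); simpl in A; unfold Rdist in A; rewrite w0 in A.
  assert (A' : Rabs (w y - 1) < 1 - al).
  { apply A; split; [split; [exact I|lra]|]; rewrite Rabs_right; lra. }
  apply Rabs_lt_between in A'; lra. }
assert (Hstrict : forall y, 0 < y -> (forall t, 0 < t < y -> al < w t) -> slope y < 0).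
{ intros y Hy H.
  assert (A := increasing_lt (fun t => - slope t)
    (fun t => - (t ^ 2 * (al ^ 2 * w t - w t ^ 3) / 4)) 0 y Hy).
  cbv beta in A; rewrite slope_0 in A.
  assert (- 0 < - slope y); [|lra].
  apply A.
  - intros t Ht; apply (continuity_pt_opp slope), slope_continuity; lra.
  - intros t Ht.
    apply (is_derive_opp slope), is_derive_slope; lra.
  - intros t Ht; specialize (H t Ht).
    assert (B : 0 < t ^ 2) by (apply pow_lt; lra).
    assert (B1 : 0 < w t ^ 3 - al ^ 2 * w t).
    { replace (w t ^ 3 - al ^ 2 * w t) with (w t * ((w t - al) * (w t + al))) by ring.
      apply Rmult_lt_0_compat; [lra|]; apply Rmult_lt_0_compat; lra. }
    nra. }
destruct Hnear as [d [Hd Hnear]].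
assert (Hsd : slope d < 0) by (apply Hstrict; [lra|]; intros; apply Hnear; lra).
assert (Hsx : 0 <= slope x).
{ rewrite slope_eq by assumption; assert (A := pow2_ge_0 x); nra. }
destruct (first_zero slope d x) as [c [Hc1 [Hc2 Hc3]]]; try assumption; [lra| |].
{ intros; apply slope_continuity; lra. }
rewrite slope_eq in Hc2 by lra.
assert (Hc4 : Derive w c = 0).
{ assert (A : c ^ 2 <> 0) by (apply pow_nonzero; lra).
  destruct (Rmult_integral _ _ Hc2); [contradiction|assumption]. }
assert (Hcw := w_pos c ltac:(lra)).
assert (Hwc : al < w c).
{ assert (A := energy_nonneg c ltac:(lra)); unfold energy in A; rewrite Hc4 in A.
  assert (B : 2 * al ^ 2 <= w c ^ 2).
  { apply Rnot_lt_le; intros B.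
    assert (0 < w c ^ 2) by (apply pow_lt; lra); nra. }
  nra. }
assert (Hsl : forall t, d <= t <= c -> al < w t).
{ intros t Ht.
  apply Rlt_le_trans with (1 := Hwc).
  apply (nonincreasing_le w (Derive w)); [lra| | |].
  - intros; apply profile_continuity.
  - intros; apply profile_is_derive.
  - intros y Hy; assert (A := Hc3 y ltac:(lra)).
    rewrite slope_eq in A by lra.
    assert (0 < y ^ 2) by (apply pow_lt; lra); nra. }
assert (Hfin : slope c < 0).
{ apply Hstrict; [lra|]; intros t Ht.
  destruct (Rle_dec t d); [apply Hnear|apply Hsl]; lra. }
rewrite slope_eq, Hc4 in Hfin by lra; lra.
Qed.

Lemma profile_decr x y : 0 <= x <= y -> w y <= w x.
Proof.
intros H.
apply (nonincreasing_le w (Derive w)); [lra| | |].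
- intros; apply profile_continuity.
- intros; apply profile_is_derive.
- intros t Ht; left; apply profile_derive_neg; lra.
Qed.

Lemma profile_le_1 x : 0 <= x -> w x <= 1.
Proof. intros H; rewrite <- w0; apply profile_decr; lra. Qed.

(* Otherwise [x * w x * exp (al * x / 2)] would decrease at least linearly. *)
Lemma profile_decay_lower x : 0 < x -> 0 <= flux w x + al / 2 * (x * w x).
Proof.
intros Hx; apply Rnot_lt_le; intros Hneg.
(* For [U = t w] one has [Y = U' + (al / 2) U] and [Y' = (al / 2) Y - t w^3 / 4]: once negative, [Y]
   never rises again. *)
set (Y := fun t => flux w t + al / 2 * (t * w t)) in *.
assert (HY : forall t, 0 < t ->
  is_derive Y t (al / 2 * Y t - t * w t ^ 3 / 4)).
{ intros t Ht; unfold Y.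
  assert (H := is_derive_flux t Ht).
  auto_derive.
  - repeat split; [exact (ex_intro _ _ H)|apply w_der].
  - rewrite_derive H; rewrite flux_pos by assumption.
    change (Derive (fun t => w t) t) with (Derive w t); field. }
assert (HYle : forall y, x <= y -> Y y <= Y x).
{ intros y Hy.
  assert (A := nonincreasing_le (fun t => exp (- (al / 2) * (t - x)) * Y t)
    (fun t => - (exp (- (al / 2) * (t - x)) * (t * w t ^ 3 / 4))) x y Hy).
  cbv beta in A.
  assert (Hd : forall t, x <= t <= y ->
    is_derive (fun t => exp (- (al / 2) * (t - x)) * Y t) t
      (- (exp (- (al / 2) * (t - x)) * (t * w t ^ 3 / 4)))).
  { intros t Ht; assert (B := HY t ltac:(lra)).
    auto_derive; [exact (ex_intro _ _ B)|].
    rewrite_derive B; unfold Rminus; field. }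
  assert (B : exp (- (al / 2) * (y - x)) * Y y <= exp (- (al / 2) * (x - x)) * Y x).
  { apply A.
    - intros t Ht; exact (is_derive_continuity_pt _ _ _ (Hd t Ht)).
    - intros t Ht; apply Hd; lra.
    - intros t Ht; assert (B := exp_pos (- (al / 2) * (t - x))).
      assert (B1 : 0 < t * w t ^ 3 / 4).
      { apply Rdiv_lt_0_compat; [|lra].
        apply Rmult_lt_0_compat; [lra|]; apply pow_lt, w_pos; lra. }
      nra. }
  replace (- (al / 2) * (x - x)) with 0 in B by ring.
  rewrite exp_0, Rmult_1_l in B.
  assert (B1 : exp (- (al / 2) * (y - x)) <= 1).
  { rewrite <- exp_0; apply exp_le; nra. }
  assert (B2 := exp_pos (- (al / 2) * (y - x))).
  assert (HYx : Y x < 0) by exact Hneg.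
  nra. }
(* Chosen so that the linear bound forces [exp (al / 2 * (y - x)) * (y * w y)] below -1. *)
set (y := x + (1 + x * w x) / - Y x).
assert (HYx : Y x < 0) by exact Hneg.
assert (Hwx := w_pos x ltac:(lra)).
assert (Hq : 0 < (1 + x * w x) / - Y x).
{ apply Rdiv_lt_0_compat; [nra|lra]. }
assert (Hy : x <= y) by (unfold y; lra).
assert (A := nonincreasing_le (fun t => exp (al / 2 * (t - x)) * (t * w t) - Y x * (t - x))
  (fun t => exp (al / 2 * (t - x)) * Y t - Y x) x y Hy).
cbv beta in A.
assert (Hd : forall t, x <= t <= y ->
  is_derive (fun t => exp (al / 2 * (t - x)) * (t * w t) - Y x * (t - x)) t
    (exp (al / 2 * (t - x)) * Y t - Y x)).
{ intros t Ht.
  auto_derive; [apply w_der|].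
  change (Derive (fun t => w t) t) with (Derive w t).
  unfold Y at 2; rewrite flux_pos by lra; unfold Rminus; field. }
assert (B : exp (al / 2 * (y - x)) * (y * w y) - Y x * (y - x)
  <= exp (al / 2 * (x - x)) * (x * w x) - Y x * (x - x)).
{ apply A.
  - intros t Ht; exact (is_derive_continuity_pt _ _ _ (Hd t Ht)).
  - intros t Ht; apply Hd; lra.
  - intros t Ht; assert (B := HYle t ltac:(lra)).
    assert (B1 : 1 <= exp (al / 2 * (t - x))).
    { rewrite <- exp_0 at 1; apply exp_le; nra. }
    nra. }
replace (al / 2 * (x - x)) with 0 in B by ring.
rewrite exp_0 in B.
assert (B1 : Y x * (y - x) = - (1 + x * w x)) by (unfold y; field; lra).
assert (B2 := exp_pos (al / 2 * (y - x))).
assert (B3 := w_pos y ltac:(lra)).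
assert (0 <= exp (al / 2 * (y - x)) * (y * w y)) by (apply Rmult_le_pos; nra).
lra.
Qed.

(** The difference [e] of the two sides is an energy for [U = x w], with derivative [- x w^4]. If it
    were negative somewhere, it would stay below a negative constant, and [U] could not approach
    0. *)
Lemma profile_decay_upper x : 0 < x ->
  (x * w x) ^ 2 * (al ^ 2 - w x ^ 2 / 2) <= 4 * flux w x ^ 2.
Proof.
intros Hx; apply Rnot_lt_le; intros Hneg.
set (e := fun t => 4 * flux w t ^ 2 - (t * w t) ^ 2 * (al ^ 2 - w t ^ 2 / 2)) in *.
assert (Hed : forall t, 0 < t -> is_derive e t (- (t * w t ^ 4))).
{ intros t Ht; unfold e.
  assert (H := is_derive_flux t Ht).
  auto_derive.
  - repeat split; first [exact (ex_intro _ _ H)|apply w_der].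
  - rewrite_derive H; rewrite !flux_pos by assumption.
    change (Derive (fun t => w t) t) with (Derive w t); field. }
assert (Hex : e x < 0) by (unfold e; lra).
assert (Hmon : forall y, x <= y -> e y <= e x).
{ intros y Hy.
  apply (nonincreasing_le e (fun t => - (t * w t ^ 4))); [exact Hy| | |].
  - intros t Ht; apply (is_derive_continuity_pt _ _ _ (Hed t ltac:(lra))).
  - intros t Ht; apply Hed; lra.
  - intros t Ht.
    assert (0 < w t ^ 4) by (apply pow_lt, w_pos; lra).
    assert (0 < t * w t ^ 4) by (apply Rmult_lt_0_compat; lra); lra. }
(* Now [t * w t] stays away from 0, so [flux w], which is at most 1, grows
   linearly as soon as [w] is small. *)
destruct (profile_eventually_small (al / 2)) as [M HM]; [lra|].
set (x1 := Rmax x (M + 1)).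
assert (Hx1 : x <= x1) by apply Rmax_l.
assert (HM1 : M + 1 <= x1) by apply Rmax_r.
set (eta := - e x).
assert (Heta : 0 < eta) by (unfold eta; lra).
(* The minimum covers both cases, [U >= 1] and [U >= U^2]. The 8 is the 4 of the equation times the
   2 from [al^2 - w^2 >= al^2 / 2]. *)
assert (Hgrow : forall t, x1 <= t ->
  Rmin 1 (eta / al ^ 2) * al ^ 2 / 8 <= t * (al ^ 2 * w t - w t ^ 3) / 4).
{ intros t Ht.
  assert (A := Hmon t ltac:(lra)); unfold e at 1 in A.
  assert (A1 := pow2_ge_0 (flux w t)).
  assert (A2 := w_pos t ltac:(lra)).
  assert (A3 := HM t ltac:(lra) ltac:(lra)).
  assert (A4 : eta <= (t * w t) ^ 2 * al ^ 2).
  { assert (0 <= (t * w t) ^ 2 * (w t ^ 2 / 2)).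
    { apply Rmult_le_pos; [apply pow2_ge_0|].
      assert (B := pow2_ge_0 (w t)); lra. }
    unfold eta; nra. }
  assert (A5 : Rmin 1 (eta / al ^ 2) <= t * w t).
  { destruct (Rle_dec 1 (t * w t)) as [B|B].
    - apply Rle_trans with (1 := Rmin_l _ _); exact B.
    - apply Rle_trans with (1 := Rmin_r _ _).
      apply Rle_trans with ((t * w t) ^ 2).
      + apply Rle_div_l; [nra|exact A4].
      + assert (0 < t * w t) by (apply Rmult_lt_0_compat; lra); nra. }
  assert (A6 : al ^ 2 / 2 <= al ^ 2 - w t ^ 2) by nra.
  replace (t * (al ^ 2 * w t - w t ^ 3) / 4) with ((t * w t) * (al ^ 2 - w t ^ 2) / 4) by field.
  assert (A7 : 0 < t * w t) by (apply Rmult_lt_0_compat; lra).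
  assert (A8 : 0 < al ^ 2) by (apply pow_lt; lra).
  nra. }
set (r := Rmin 1 (eta / al ^ 2) * al ^ 2 / 8) in *.
assert (Hr : 0 < r).
{ unfold r; assert (A8 : 0 < al ^ 2) by (apply pow_lt; lra).
  assert (0 < Rmin 1 (eta / al ^ 2)) by (apply Rmin_glb_lt; [lra|apply Rdiv_lt_0_compat; lra]).
  nra. }
set (y := x1 + (Rabs (flux w x1) + 2) / r).
assert (Hq : 0 < (Rabs (flux w x1) + 2) / r).
{ apply Rdiv_lt_0_compat; [|exact Hr]; assert (A := Rabs_pos (flux w x1)); lra. }
assert (Hy : x1 <= y) by (unfold y; lra).
assert (A := nonincreasing_le (fun t => r * (t - x1) - flux w t)
  (fun t => r - t * (al ^ 2 * w t - w t ^ 3) / 4) x1 y Hy).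
cbv beta in A.
assert (Hd : forall t, x1 <= t <= y -> is_derive (fun t => r * (t - x1) - flux w t) t
  (r - t * (al ^ 2 * w t - w t ^ 3) / 4)).
{ intros t Ht; assert (B := is_derive_flux t ltac:(lra)).
  auto_derive; [exact (ex_intro _ _ B)|].
  rewrite_derive B; ring. }
assert (B : r * (y - x1) - flux w y <= r * (x1 - x1) - flux w x1).
{ apply A.
  - intros t Ht; exact (is_derive_continuity_pt _ _ _ (Hd t Ht)).
  - intros t Ht; apply Hd; lra.
  - intros t Ht; assert (B := Hgrow t ltac:(lra)); lra. }
assert (B1 : r * (y - x1) = Rabs (flux w x1) + 2) by (unfold y; field; lra).
assert (B2 := Rle_abs (- flux w x1)); rewrite Rabs_Ropp in B2.
assert (B3 : flux w y <= 1).
{ rewrite flux_pos by lra.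
  assert (C1 := profile_le_1 y ltac:(lra)).
  assert (C2 := profile_derive_neg y ltac:(lra)).
  assert (0 < y) by lra; nra. }
lra.
Qed.

End Profile.

(** * Validated integration *)

Open Scope Z_scope.

(* Coefficients of polynomials are in units of [1 / D], the parameter [al] is in
   units of [1 / A]. *)
Definition D : Z := 2 ^ 36.
Definition A : Z := 20000.

(** Returns a product of two coefficients in units of [1 / D] to that unit; 36 is the exponent in
    [D]. *)
Definition rescale (p : list Z) : list Z :=
  firstn 3 (map (fun z => Z.shiftr z 36) p).

Fixpoint dot (p q : list (list Z)) : list Z :=
  match p, q with
  | a :: p', b :: q' => padd (pmul a b) (dot p' q')
  | _, _ => []
  end.

(* Rounded Taylor coefficients of [w] at [x = n], truncated to degree 2 in the
   parameter; [ra] and [rs] hold those of [w] and [w^2], the latest first.  The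
   recursion is singular at [n = 0].  Nothing is proved about the result: its
   residual is bounded a posteriori. *)
Fixpoint wtaylor (fuel : nat) (al2 : list Z) (n i : Z)
    (ra rs : list (list Z)) (g0 : list Z) : list (list Z) :=
  match fuel with
  | O => rev ra
  | S fuel =>
    let a := rev ra in
    let rs := rescale (dot a (tl ra)) :: rs in
    let g := map (fun z => Z.shiftr z 2)
      (padd (rescale (pmul al2 (nth 1 ra []))) (pscal (-1) (rescale (dot rs a)))) in
    let next :=
      if n =? 0 then map (fun z => z / ((i + 2) * (i + 3))) g
      else map (fun z => z / (n * (i + 1) * (i + 2)))
        (padd (padd (pscal n g) g0) (pscal (- (i + 1) * (i + 2)) (nth 0 ra []))) in
    wtaylor fuel al2 n (i + 1) (next :: ra) rs g
  end.

(** Taylor coefficients of a solution of [f'' = - (3/4) s f]. As [tl rf] lists the coefficients of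
    index [i] down to 0, [dot] is a coefficient of the Cauchy product. *)
Fixpoint ftaylor (fuel : nat) (s : list (list Z)) (i : Z) (rf : list (list Z)) : list (list Z) :=
  match fuel with
  | O => rev rf
  | S fuel =>
    let c := rescale (dot s (tl rf)) in
    ftaylor fuel s (i + 1) (map (fun z => (-3 * z) / (4 * (i + 1) * (i + 2))) c :: rf)
  end.

(* [4 D^3 A^2] times the residual of [P / D] in the equation
   [x w'' + 2 w' + x (w^3 - al^2 w) / 4 = 0], [x = n + theta]. *)
Definition residual (al : list Z) (n : Z) (P : list (list Z)) : list (list Z) :=
  qadd
    (qmul [[n]; [1]]
      (qadd (qscal (4 * (D * D) * (A * A)) (qder (qder P)))
        (qadd (qscal (A * A) (qmul P (qmul P P)))
              (qscal (- (D * D)) (qmul [pmul al al] P)))))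
    (qscal (8 * (D * D) * (A * A)) (qder P)).

(* At [x = n], [val] and [der] approximate [D w] and [D w'] as polynomials in the
   parameter, [err] bounds [(lam / 16)^2 e0^2 + e1^2] with [e0], [e1] the errors
   of [D x w] and of its derivative, and [bnd] bounds [D w]. *)
Record state := State {
  val : list Z;
  der : list Z;
  err : Z;
  lam : Z;
  bnd : Z }.

(** The two leading coefficients are put back explicitly, so that the shape required by [step_sound]
    holds by conversion and the cell starts exactly at the stored values. *)
Definition wpoly (deg : nat) (al : list Z) (n : Z) (s : state) : list (list Z) :=
  let al2 := map (fun z => z * D / (A * A)) (pmul al al) in
  val s :: der s :: skipn 2 (wtaylor deg al2 n 0 [der s; val s] [] []).

(* [(8 / 7)^(l + 1)] bounds the Gronwall factor [exp (2 (l / 16) + 1 / 8)]. *)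
Definition growth (l e : Z) : Z := 8 ^ (l + 1) * e / 7 ^ (l + 1) + 1.

(** Bounds [W^2 + W p + p^2], the cofactor of [W - p] in [W^3 - p^3]: it enters the coefficient of
    the linear equation for the error. *)
Definition kbound (P : list (list Z)) (s : state) : Z :=
  let b := bnd s in let p := qabs P in b * b + b * p + p * p.

(** The weight [lam / 16] must satisfy [64 kbound <= lam^2 D^2]; the square root proposes such an
    integer and [step_ok] checks it. The rate never grows, since an error bound obtained with one
    weight stays valid for a smaller one. The floor 3 accommodates [al <= 3 / 8]. *)
Definition rate (P : list (list Z)) (s : state) : Z :=
  Z.min (lam s) (Z.max 3 (Z.sqrt (64 * kbound P s) / D + 1)).

Definition step_ok (al : list Z) (P : list (list Z)) (s : state) : bool :=
  let l := rate P s in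
  (64 * kbound P s <=? l * l * (D * D)) && (64 * pub (pmul al al) <=? l * l * (A * A)).

(** The tracked error is that of [x w], hence the division by [n + 1] in the new bound on [w]. The
    minimum with the old bound is justified because [w] decreases. *)
Definition step (al : list Z) (n : Z) (P : list (list Z)) (s : state) : state :=
  let r := qabs (residual al n P) / (4 * (D * D) * (A * A)) + 1 in
  let l := rate P s in
  let e := growth l (err s + 8 * (r * r)) in
  let a := qsum P in
  State a (qsum (qder P)) e l
    (Z.min (bnd s) (pub a + 16 * (Z.sqrt e + 1) / (l * (n + 1)) + 1)).

(** [d] bounds the error of [U'] and [16 d / lam] that of [U]. In both tests [U] carries a factor at
    most [al / 2 <= 1 / 2] relative to [U']. *)
Definition slack (s : state) : Z := let d := Z.sqrt (err s) + 1 in d + 8 * d / lam s + 1.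

Definition flux_poly (n : Z) (s : state) : list Z := padd (val s) (pscal n (der s)).

(* Violation of [U' + (al / 2) U >= 0] for [U = x w]. *)
Definition too_fast (al : list Z) (n : Z) (s : state) : bool :=
  pub (padd (pscal (2 * A) (flux_poly n s)) (pscal n (pmul al (val s))))
    + 2 * A * slack s <? 0.

(* Violation of [4 U'^2 >= U^2 (al^2 - w^2 / 2)]; [q / 2^10] is a lower bound for
   [sqrt (1 - w^2 / (2 al^2))], which makes the test linear in [U] and [U']. *)
Definition too_slow (al : list Z) (n : Z) (s : state) : bool :=
  let am := - pub (pscal (-1) al) in
  let b := bnd s * bnd s * (A * A) in
  let c := am * am * (D * D) in
  let q := Z.sqrt (2 ^ 20 - 2 ^ 19 * b / c - 1) in
  let v := pscal (2 ^ 11 * A) (flux_poly n s) in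
  let u := pscal (- (q * n)) (pmul al (val s)) in
  let e := 2 ^ 11 * A * slack s in
  (0 <? am) && (0 <=? q) && (2 ^ 19 * b <=? (2 ^ 20 - q * q) * c) &&
  (pub (padd v u) + e <? 0) && (pub (padd (pscal (-1) v) u) + e <? 0).

(** [pub] bounds over all [|y| <= 1], so a successful test rules out the whole parameter interval at
    one integer point. *)
Fixpoint excluded (deg fuel : nat) (al : list Z) (n : Z) (s : state) : bool :=
  match fuel with
  | O => false
  | S fuel =>
    let P := wpoly deg al n s in
    let s' := step al n P s in
    step_ok al P s &&
    (too_fast al (n + 1) s' || too_slow al (n + 1) s' || excluded deg fuel al (n + 1) s')
  end.

(** 14 is the least integer with [64 * 3 <= 14^2], the requirement on the rate where [w] and its
    approximation are close to 1. *)
Definition start : state := State [D] [] 0 14 D.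

Record fstate := FState { fval : list Z; fder : list Z; ferr : Z }.

Definition fpoly (deg : nat) (P : list (list Z)) (f : fstate) : list (list Z) :=
  fval f :: fder f ::
  skipn 2 (ftaylor deg (map rescale (qmul P P)) 0 [fder f; fval f]).

Definition fresidual (P F : list (list Z)) : list (list Z) :=
  qadd (qscal (4 * (D * D)) (qder (qder F))) (qscal 3 (qmul (qmul P P) F)).

(* [s] is the state at the left end of the cell and [s'] at its right end. *)
Definition fstep (n : Z) (P F : list (list Z)) (s s' : state) (f : fstate) : fstate :=
  let d := Z.sqrt (err s') + 1 in
  let dw := if n =? 0 then d else 16 * d / (lam s' * n) + 1 in
  let r := qabs (fresidual P F) / (4 * (D * D)) + 1
    + 3 * dw * (bnd s + qabs P) * qabs F / (4 * (D * D)) + 1 in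
  FState (qsum F) (qsum (qder F)) (growth (lam s') (ferr f + 8 * (r * r))).

Definition fstart : fstate := FState [] [D] 0.

(* [f' > 0] on [0, 1), [f > 0] on [1, 4) and [f' < 0] on [4, 14). *)
Definition sign_ok (n : Z) (F : list (list Z)) (s' : state) (f' : fstate) : bool :=
  let d := Z.sqrt (ferr f') + 1 in
  if n =? 0 then qub (qscal (-1) (qder F)) + d <? 0
  else if n <? 4 then qub (qscal (-1) F) + 16 * d / lam s' + 1 <? 0
  else qub (qder F) + d <? 0.

(* The constants are the hypotheses of [linearized_tail] below. *)
Definition tail_ok (s : state) (f : fstate) : bool :=
  let d := Z.sqrt (ferr f) + 1 in
  (pub (flux_poly 14 s) + (Z.sqrt (err s) + 1) <? 0) &&
  (pub (fval f) + 16 * d / lam s + 1 <? 0) && (100 * bnd s <=? 8 * D) &&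
  (168 * (pub (pscal (-1) (fval f)) + 16 * d / lam s + 1) <? 10000 * (- pub (fder f) - d)).

(** The inequality with 192 says [3/4 w^2 <= (lam / 16)^2], so [f] can be tracked with the same
    weight as [w]. *)
Fixpoint window_ok (deg fuel : nat) (al : list Z) (n : Z) (s : state) (f : fstate) : bool :=
  match fuel with
  | O => tail_ok s f
  | S fuel =>
    let P := wpoly deg al n s in
    let s' := step al n P s in
    let F := fpoly deg P f in
    let f' := fstep n P F s s' f in
    step_ok al P s && (192 * (bnd s * bnd s) <=? lam s' * lam s' * (D * D)) &&
    sign_ok n F s' f' && window_ok deg fuel al (n + 1) s' f'
  end.

Close Scope Z_scope.

(** * Rounding and the real meaning of the integer bounds *)

Lemma div_up (a b : Z) : (0 < b)%Z -> IZR a / IZR b <= IZR (a / b + 1).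
Proof.
intros Hb.
assert (Hb' : 0 < IZR b) by now apply (IZR_lt 0).
apply Rle_div_l; [exact Hb'|].
rewrite <- mult_IZR; apply IZR_le.
assert (H := Z_div_mod_eq_full a b).
assert (H1 := Z.mod_pos_bound a b Hb); nia.
Qed.

Lemma growth_up (l e : Z) : (0 < l)%Z ->
  0 <= IZR e -> exp (2 * (IZR l / 16) + 1 / 8) * IZR e <= IZR (growth l e).
Proof.
intros Hl He; unfold growth.
assert (H7 : (0 < 7 ^ (l + 1))%Z) by (apply Z.pow_pos_nonneg; lia).
apply Rle_trans with (2 := div_up _ _ H7).
set (n := Z.to_nat (l + 1)).
assert (Hn : (l + 1)%Z = Z.of_nat n) by (unfold n; rewrite Z2Nat.id; lia).
rewrite mult_IZR, Hn, <- !pow_IZR.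
assert (H := exp_eighths n).
replace (2 * (IZR l / 16) + 1 / 8) with (INR n / 8).
- replace (IZR 8 ^ n * IZR e / IZR 7 ^ n) with ((8 / 7) ^ n * IZR e).
  + now apply Rmult_le_compat_r.
  + unfold Rdiv; rewrite Rpow_mult_distr, <- pow_inv; ring.
- rewrite INR_IZR_INZ, <- Hn, plus_IZR; field.
Qed.

Lemma sqrt_err (l e : Z) (a b : R) : (0 < l)%Z -> (0 <= e)%Z ->
  (IZR l / 16) ^ 2 * a ^ 2 + b ^ 2 <= IZR e ->
  Rabs b <= IZR (Z.sqrt e + 1) /\ Rabs a <= 16 * IZR (Z.sqrt e + 1) / IZR l.
Proof.
intros Hl He H.
assert (Hs := Z.sqrt_spec e He).
assert (Hs0 := Z.sqrt_nonneg e).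
set (d := (Z.sqrt e + 1)%Z).
assert (Hd : IZR e <= IZR d ^ 2).
{ replace (IZR d ^ 2) with (IZR (d * d)) by (rewrite mult_IZR; ring).
  apply IZR_le; unfold d; cbv zeta in Hs; nia. }
assert (Hd0 : 0 <= IZR d) by (apply (IZR_le 0); unfold d; lia).
assert (Hl' : 0 < IZR l) by now apply (IZR_lt 0).
assert (A1 := pow2_ge_0 a); assert (A2 := pow2_ge_0 b).
assert (A3 : 0 <= (IZR l / 16) ^ 2) by apply pow2_ge_0.
split.
- apply Rabs_le; nra.
- apply Rle_div_r; [exact Hl'|].
  assert (A4 : (IZR l / 16 * Rabs a) ^ 2 <= IZR d ^ 2).
  { rewrite Rpow_mult_distr, pow2_abs; nra. }
  assert (A5 := Rabs_pos a).
  assert (A6 : IZR l / 16 * Rabs a <= IZR d) by nra.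
  lra.
Qed.

Lemma D_pos : 0 < IZR D.
Proof. apply (IZR_lt 0); reflexivity. Qed.

Lemma A_pos : 0 < IZR A.
Proof. apply (IZR_lt 0); reflexivity. Qed.

Lemma is_derive_qev_shift y P (n x : R) :
  is_derive (fun t => qev (t - n) y P) x (qev (x - n) y (qder P)).
Proof.
replace (qev (x - n) y (qder P)) with (scal 1 (qev (x - n) y (qder P)))
  by (unfold scal; simpl; unfold mult; simpl; ring).
apply (is_derive_comp (fun t => qev t y P) (fun t => t - n)).
- apply is_derive_qev.
- auto_derive; [trivial|ring].
Qed.

Lemma qev_shift_continuity y P (n x : R) : continuity_pt (fun t => qev (t - n) y P) x.
Proof. exact (is_derive_continuity_pt _ _ _ (is_derive_qev_shift y P n x)). Qed.

Lemma is_derive_sub_id_mul (u g : R -> R) (c x a b : R) :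
  is_derive u x a -> is_derive g x b ->
  is_derive (fun t => c * u t - t * g t) x (c * a - (g x + x * b)).
Proof.
intros Hu Hg; auto_derive.
- split; [exact (ex_intro _ _ Hu)|split; [exact (ex_intro _ _ Hg)|trivial]].
- rewrite_derive Hu; rewrite_derive Hg; ring.
Qed.

Lemma is_derive_sub_add_id_mul (u g h : R -> R) (c x a b d : R) :
  is_derive u x a -> is_derive g x b -> is_derive h x d ->
  is_derive (fun t => c * u t - (g t + t * h t)) x (c * a - (b + (h x + x * d))).
Proof.
intros Hu Hg Hh; auto_derive.
- repeat split; [exact (ex_intro _ _ Hu)|exact (ex_intro _ _ Hg)|exact (ex_intro _ _ Hh)].
- rewrite_derive Hu; rewrite_derive Hg; rewrite_derive Hh; ring.
Qed.

(** * Error propagation over one cell *)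

Section Steps.
Variables (al : R) (w : R -> R) (y : R) (alp : list Z).
Hypothesis Hw : profile al w.
Hypothesis Hy : Rabs y <= 1.
Hypothesis Hal : IZR A * al = pev y alp.

(* The errors of [x * P] against [D * x * w] and of its derivative, where [P]
   approximates [D * w] on the cell [n, n + 1]. *)
Let gap (n : Z) (P : list (list Z)) (x : R) : R :=
  IZR D * (x * w x) - x * qev (x - IZR n) y P.
Let fgap (n : Z) (P : list (list Z)) (x : R) : R :=
  IZR D * flux w x - (qev (x - IZR n) y P + x * qev (x - IZR n) y (qder P)).

Lemma gap_continuity n P x : continuity_pt (gap n P) x.
Proof.
unfold gap.
apply (continuity_pt_minus (fun x => IZR D * (x * w x)) (fun x => x * qev (x - IZR n) y P)).
- apply (continuity_pt_mult (fun _ => IZR D) (fun x => x * w x)).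
  + apply continuity_pt_const; intros ? ?; reflexivity.
  + apply (continuity_pt_mult (fun x => x) w);
      [apply derivable_continuous_pt, derivable_pt_id|exact (profile_continuity _ _ Hw x)].
- apply (continuity_pt_mult (fun x => x) (fun x => qev (x - IZR n) y P));
    [apply derivable_continuous_pt, derivable_pt_id|apply qev_shift_continuity].
Qed.

Lemma fgap_continuity n P x : 0 <= x -> continuity_pt (fgap n P) x.
Proof.
intros Hx; unfold fgap.
apply (continuity_pt_minus (fun x => IZR D * flux w x)
  (fun x => qev (x - IZR n) y P + x * qev (x - IZR n) y (qder P))).
- apply (continuity_pt_mult (fun _ => IZR D) (flux w)).
  + apply continuity_pt_const; intros ? ?; reflexivity.
  + exact (flux_continuity _ _ Hw x Hx).
- apply (continuity_pt_plus (fun x => qev (x - IZR n) y P)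
    (fun x => x * qev (x - IZR n) y (qder P))); [apply qev_shift_continuity|].
  apply (continuity_pt_mult (fun x => x) (fun x => qev (x - IZR n) y (qder P)));
    [apply derivable_continuous_pt, derivable_pt_id|apply qev_shift_continuity].
Qed.

Lemma is_derive_gap n P x : 0 < x -> is_derive (gap n P) x (fgap n P x).
Proof.
intros Hx; unfold gap, fgap.
apply (is_derive_sub_id_mul (fun t => t * w t) (fun t => qev (t - IZR n) y P)).
- exact (is_derive_moment _ _ Hw x Hx).
- apply is_derive_qev_shift.
Qed.

Lemma residual_eq n P x :
  qev (x - IZR n) y (residual alp n P) =
  4 * IZR D ^ 2 * IZR A ^ 2 *
  (x * qev (x - IZR n) y (qder (qder P)) + 2 * qev (x - IZR n) y (qder P)
   + x * (qev (x - IZR n) y P ^ 3 / IZR D ^ 2 - al ^ 2 * qev (x - IZR n) y P) / 4).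
Proof.
unfold residual.
rewrite !qev_add, !qev_mul, !qev_add, !qev_scal, !qev_mul.
rewrite !qev_cons, pev_mul, <- Hal, !pev_cons.
rewrite !mult_IZR, opp_IZR, mult_IZR.
set (p := qev (x - IZR n) y P).
set (p1 := qev (x - IZR n) y (qder P)).
set (p2 := qev (x - IZR n) y (qder (qder P))).
change (qev (x - IZR n) y []) with 0; change (pev y []) with 0.
assert (HD := D_pos); field; lra.
Qed.

(** Subtracting the equation satisfied by the polynomial up to its residual, and factoring the
    difference of cubes, leaves an equation linear in [gap] whose source is the residual. *)
Lemma is_derive_fgap n P x : 0 < x ->
  is_derive (fgap n P) x
   ((al ^ 2 - ((IZR D * w x) ^ 2 + IZR D * w x * qev (x - IZR n) y P
      + qev (x - IZR n) y P ^ 2) / IZR D ^ 2) / 4 * gap n P x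
    + - qev (x - IZR n) y (residual alp n P) / (4 * IZR D ^ 2 * IZR A ^ 2)).
Proof.
intros Hx.
assert (HD := D_pos); assert (HA := A_pos).
rewrite residual_eq; unfold gap.
match goal with |- is_derive _ _ ?l =>
  replace l with (IZR D * (x * (al ^ 2 * w x - w x ^ 3) / 4)
    - (qev (x - IZR n) y (qder P) + (qev (x - IZR n) y (qder P)
         + x * qev (x - IZR n) y (qder (qder P))))) by (field; lra)
end.
apply (is_derive_sub_add_id_mul (flux w) (fun t => qev (t - IZR n) y P)
  (fun t => qev (t - IZR n) y (qder P))).
- exact (is_derive_flux _ _ Hw x Hx).
- apply is_derive_qev_shift.
- apply is_derive_qev_shift.
Qed.

Definition tracks (n : Z) (s : state) : Prop :=
  (0 <= err s)%Z /\ (0 < lam s)%Z /\ IZR D * w (IZR n) <= IZR (bnd s) /\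
  (IZR (lam s) / 16) ^ 2 *
    (IZR D * (IZR n * w (IZR n)) - IZR n * pev y (val s)) ^ 2 +
  (IZR D * flux w (IZR n) - (pev y (val s) + IZR n * pev y (der s))) ^ 2
  <= IZR (err s).

Lemma tracks_start : tracks 0 start.
Proof.
unfold tracks, start; cbn [err lam bnd val der].
rewrite (flux_0 _ _ Hw), (proj1 (proj2 Hw)), pev_cons.
change (pev y []) with 0.
split; [lia|split; [lia|split; [lra|right; ring]]].
Qed.

Lemma step_sound n s P T : (0 <= n)%Z -> tracks n s ->
  P = val s :: der s :: T -> step_ok alp P s = true ->
  tracks (n + 1) (step alp n P s) /\
  forall x, IZR n <= x <= IZR n + 1 ->
    (IZR (lam (step alp n P s)) / 16) ^ 2 * gap n P x ^ 2 + fgap n P x ^ 2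
    <= IZR (err (step alp n P s)).
Proof.
intros Hn [He [Hl [Hb Herr]]] HP Hok.
assert (HD := D_pos); assert (HA := A_pos).
assert (Hn' : 0 <= IZR n) by now apply (IZR_le 0).
unfold step_ok in Hok; apply andb_prop in Hok; destruct Hok as [Hk1 Hk2].
apply Z.leb_le, IZR_le in Hk1; apply Z.leb_le, IZR_le in Hk2.
rewrite !mult_IZR in Hk1, Hk2.
set (l := rate P s) in *.
assert (Hl1 : (0 < l <= lam s)%Z) by (unfold l, rate; lia).
assert (Hl1' : 0 < IZR l) by (apply (IZR_lt 0); lia).
assert (Hl2' : IZR l <= IZR (lam s)) by (apply IZR_le; lia).
set (r := (qabs (residual alp n P) / (4 * (D * D) * (A * A)) + 1)%Z).
assert (Hcell : forall x, IZR n <= x <= IZR n + 1 ->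
  (IZR l / 16) ^ 2 * gap n P x ^ 2 + fgap n P x ^ 2 <=
  IZR (growth l (err s + 8 * (r * r)))).
{ intros x Hx.
  assert (Hge : 0 <= IZR (err s + 8 * (r * r))) by (apply (IZR_le 0); nia).
  apply Rle_trans with (2 := growth_up _ _ (proj1 Hl1) Hge).
  replace (IZR (err s + 8 * (r * r))) with (IZR (err s) + 8 * IZR r ^ 2)
    by (rewrite plus_IZR, !mult_IZR; ring).
  apply (gronwall_cell (gap n P) (fgap n P)
    (fun x => (al ^ 2 - ((IZR D * w x) ^ 2 + IZR D * w x * qev (x - IZR n) y P
      + qev (x - IZR n) y P ^ 2) / IZR D ^ 2) / 4)
    (fun x => - qev (x - IZR n) y (residual alp n P) / (4 * IZR D ^ 2 * IZR A ^ 2))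
    (IZR n) x).
  - lra.
  - lra.
  - now apply (IZR_le 0).
  - intros; apply gap_continuity.
  - intros; apply fgap_continuity; lra.
  - intros; apply is_derive_gap; lra.
  - intros; apply is_derive_fgap; lra.
  - intros t Ht.
    assert (Hp := qev_qabs (t - IZR n) y P ltac:(lra) Hy).
    set (p := qev (t - IZR n) y P) in *.
    assert (HW0 : 0 < IZR D * w t).
    { apply Rmult_lt_0_compat; [exact HD|]; apply (proj1 (proj2 (proj2 Hw))); lra. }
    assert (HWb : IZR D * w t <= IZR (bnd s)).
    { apply Rle_trans with (2 := Hb); apply Rmult_le_compat_l; [lra|].
      apply (profile_decr _ _ Hw); lra. }
    set (W := IZR D * w t) in *.
    assert (Hkb : W ^ 2 + W * p + p ^ 2 <= IZR (kbound P s)).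
    { unfold kbound; cbv zeta; rewrite !plus_IZR, !mult_IZR.
      apply Rabs_le_between in Hp.
      assert (0 <= IZR (qabs P)) by lra.
      assert (W ^ 2 <= IZR (bnd s) * IZR (bnd s)) by nra.
      assert (p ^ 2 <= IZR (qabs P) * IZR (qabs P)) by nra.
      assert (W * p <= IZR (bnd s) * IZR (qabs P)) by nra.
      lra. }
    assert (Hk0 : 0 <= W ^ 2 + W * p + p ^ 2).
    { assert (B := pow2_ge_0 (W + p)); assert (B1 := pow2_ge_0 W);
      assert (B2 := pow2_ge_0 p); nra. }
    assert (Hk3 : (W ^ 2 + W * p + p ^ 2) / IZR D ^ 2 <= IZR l ^ 2 / 64).
    { apply Rle_div_l; [apply pow_lt; exact HD|]; nra. }
    assert (Hk4 : 0 <= (W ^ 2 + W * p + p ^ 2) / IZR D ^ 2).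
    { apply Rmult_le_pos; [exact Hk0|].
      left; apply Rinv_0_lt_compat, pow_lt; exact HD. }
    assert (Hal2 : al ^ 2 <= IZR l ^ 2 / 64).
    { assert (B := pev_pub y (pmul alp alp) Hy); rewrite pev_mul, <- Hal in B.
      assert (B1 : 0 < IZR A ^ 2) by (apply pow_lt; exact HA).
      assert (B2 : IZR A ^ 2 * (64 * al ^ 2) <= IZR A ^ 2 * IZR l ^ 2) by nra.
      apply Rmult_le_reg_l in B2; lra. }
    assert (Hal0 := pow2_ge_0 al).
    (* The coefficient is a difference of two nonnegative quantities, so it is bounded by the larger
       of them rather than by their sum. *)
    apply Rabs_le; split; nra.
  - intros t Ht.
    assert (Hr := qev_qabs (t - IZR n) y (residual alp n P) ltac:(lra) Hy).
    set (q := qev (t - IZR n) y (residual alp n P)) in *.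
    assert (B : 0 < 4 * IZR D ^ 2 * IZR A ^ 2).
    { assert (0 < IZR D ^ 2) by (apply pow_lt; exact HD).
      assert (0 < IZR A ^ 2) by (apply pow_lt; exact HA).
      apply Rmult_lt_0_compat; lra. }
    unfold Rdiv; rewrite Rabs_mult, Rabs_Ropp, Rabs_inv.
    rewrite (Rabs_right (4 * IZR D ^ 2 * IZR A ^ 2)) by lra.
    apply Rle_trans with (IZR (qabs (residual alp n P)) / IZR (4 * (D * D) * (A * A))).
    + rewrite !mult_IZR.
      replace (4 * (IZR D * IZR D) * (IZR A * IZR A)) with (4 * IZR D ^ 2 * IZR A ^ 2) by ring.
      apply Rmult_le_compat_r; [|exact Hr].
      left; now apply Rinv_0_lt_compat.
    + apply div_up; reflexivity.
  - apply Rle_trans with (2 := Herr).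
    unfold gap, fgap; rewrite Rminus_diag, HP, qev_start, qev_qder_start.
    set (g := IZR D * (IZR n * w (IZR n)) - IZR n * pev y (val s)).
    assert (B := pow2_ge_0 g).
    apply Rplus_le_compat_r, Rmult_le_compat_r; [exact B|].
    apply pow_incr; lra. }
split; [|exact Hcell].
assert (He' : (0 <= growth l (err s + 8 * (r * r)))%Z).
{ unfold growth.
  assert (0 <= 8 ^ (l + 1) * (err s + 8 * (r * r)) / 7 ^ (l + 1))%Z; [|lia].
  apply Z.div_pos; [|apply Z.pow_pos_nonneg; lia].
  apply Z.mul_nonneg_nonneg; [apply Z.pow_nonneg; lia|nia]. }
specialize (Hcell (IZR n + 1) ltac:(lra)).
unfold gap, fgap in Hcell.
replace (IZR n + 1 - IZR n) with 1 in Hcell by ring.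
rewrite <- !pev_qsum, <- (plus_IZR n 1) in Hcell.
unfold tracks, step; fold l; fold r; cbv zeta.
cbn [err lam bnd val der].
split; [exact He'|]; split; [lia|]; split; [|exact Hcell].
set (e := growth l (err s + 8 * (r * r))) in *.
set (a := qsum P) in *.
assert (Hn1 : 1 <= IZR (n + 1)) by (apply (IZR_le 1); lia).
assert (HWb : IZR D * w (IZR (n + 1)) <= IZR (bnd s)).
{ apply Rle_trans with (2 := Hb); apply Rmult_le_compat_l; [lra|].
  apply (profile_decr _ _ Hw); split; [exact Hn'|apply IZR_le; lia]. }
destruct (sqrt_err _ _ _ _ (proj1 Hl1) He' Hcell) as [_ Hg].
assert (HWa : IZR D * w (IZR (n + 1)) <=
  IZR (pub a + 16 * (Z.sqrt e + 1) / (l * (n + 1)) + 1)).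
{ rewrite <- Z.add_assoc, (plus_IZR (pub a)).
  assert (B := pev_pub y a Hy).
  assert (B1 := div_up (16 * (Z.sqrt e + 1)) (l * (n + 1)) ltac:(nia)).
  rewrite (mult_IZR l), (mult_IZR 16) in B1.
  assert (B2 : IZR D * w (IZR (n + 1)) - pev y a <=
    16 * IZR (Z.sqrt e + 1) / (IZR l * IZR (n + 1))).
  { replace (16 * IZR (Z.sqrt e + 1) / (IZR l * IZR (n + 1)))
      with (16 * IZR (Z.sqrt e + 1) / IZR l / IZR (n + 1)) by (field; lra).
    apply Rle_div_r; [lra|].
    apply Rle_trans with (2 := Hg), Rle_trans with (2 := Rle_abs _); right; ring. }
  lra. }
destruct (Z.min_dec (bnd s) (pub a + 16 * (Z.sqrt e + 1) / (l * (n + 1)) + 1)) as [E|E];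
  rewrite E; assumption.
Qed.

End Steps.

Lemma step_lam al n P s : (0 < lam s)%Z -> (0 < lam (step al n P s) <= lam s)%Z.
Proof. unfold step, rate; cbn [lam]; lia. Qed.

(** * Excluding parameter intervals *)

Section Exclusion.
Variables (al : R) (w : R -> R) (y : R) (alp : list Z).
Hypothesis Hw : profile al w.
Hypothesis Hy : Rabs y <= 1.
Hypothesis Hal : IZR A * al = pev y alp.

Lemma slack_up s : (0 < lam s)%Z ->
  IZR (Z.sqrt (err s) + 1) + 8 * IZR (Z.sqrt (err s) + 1) / IZR (lam s) <= IZR (slack s).
Proof.
intros Hl; unfold slack; cbv zeta.
rewrite <- Z.add_assoc, (plus_IZR (Z.sqrt (err s) + 1)).
apply Rplus_le_compat_l.
apply Rle_trans with (2 := div_up _ _ Hl); rewrite mult_IZR; lra.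
Qed.

Lemma tracks_bounds n s : tracks w y n s ->
  Rabs (IZR D * flux w (IZR n) - pev y (flux_poly n s)) <= IZR (Z.sqrt (err s) + 1) /\
  Rabs (IZR D * (IZR n * w (IZR n)) - IZR n * pev y (val s))
    <= 16 * IZR (Z.sqrt (err s) + 1) / IZR (lam s).
Proof.
intros [He [Hl [_ Herr]]].
unfold flux_poly; rewrite pev_add, pev_scal.
exact (sqrt_err _ _ _ _ Hl He Herr).
Qed.

Lemma al_bounds : 0 < al <= 1.
Proof.
assert (H := profile_al_le _ _ Hw); assert (H0 := proj1 Hw); split; nra.
Qed.

Lemma too_fast_sound n s : (0 < n)%Z -> tracks w y n s -> too_fast alp n s = true -> False.
Proof.
intros Hn Ht Hf.
assert (HD := D_pos); assert (HA := A_pos); assert (Ha := al_bounds).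
assert (Hn' : 0 < IZR n) by now apply (IZR_lt 0).
destruct (tracks_bounds n s Ht) as [H1 H2].
assert (Hl : (0 < lam s)%Z) by apply Ht.
assert (Hs := slack_up s Hl).
unfold too_fast in Hf; apply Z.ltb_lt, IZR_lt in Hf.
rewrite plus_IZR, !mult_IZR in Hf.
assert (H3 := pev_pub y _ Hy : pev y (padd (pscal (2 * A) (flux_poly n s))
  (pscal n (pmul alp (val s)))) <= _).
rewrite pev_add, !pev_scal, pev_mul, mult_IZR, <- Hal in H3.
assert (H4 := profile_decay_lower _ _ Hw (IZR n) Hn').
apply Rabs_le_between in H1; apply Rabs_le_between in H2.
set (d := IZR (Z.sqrt (err s) + 1)) in *.
set (d2 := d / IZR (lam s)).
replace (16 * d / IZR (lam s)) with (16 * d2) in H2 by (unfold d2, Rdiv; ring).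
replace (8 * d / IZR (lam s)) with (8 * d2) in Hs by (unfold d2, Rdiv; ring).
set (u := IZR n * w (IZR n)) in *.
assert (H5 : 0 <= 2 * IZR A * (IZR D * flux w (IZR n)) + IZR A * al * (IZR D * u)).
{ replace (2 * IZR A * (IZR D * flux w (IZR n)) + IZR A * al * (IZR D * u))
    with (2 * IZR A * IZR D * (flux w (IZR n) + al / 2 * u)) by field.
  apply Rmult_le_pos; [|exact H4]; nra. }
assert (Hd2 : 0 <= d2) by lra.
assert (H6 : IZR A * al * (IZR D * u) <= IZR A * al * (IZR n * pev y (val s)) + IZR A * (16 * d2)).
{ assert (H7 : IZR A * al * (IZR D * u) <= IZR A * al * (IZR n * pev y (val s) + 16 * d2)).
  { apply Rmult_le_compat_l; [nra|lra]. }
  assert (H8 : IZR A * al * (16 * d2) <= IZR A * (16 * d2)).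
  { apply Rmult_le_compat_r; nra. }
  lra. }
assert (H7 : 2 * IZR A * (IZR D * flux w (IZR n)) <=
  2 * IZR A * (pev y (flux_poly n s) + d)) by (apply Rmult_le_compat_l; lra).
assert (H8 : 2 * IZR A * (d + 8 * d2) <= 2 * IZR A * IZR (slack s))
  by (apply Rmult_le_compat_l; lra).
lra.
Qed.

(** The two linear tests give [2^11 |U'| < q al U], and the choice of [q] gives
    [(q / 2^10)^2 al^2 <= al^2 - w^2 / 2]; squaring contradicts [profile_decay_upper]. The bound
    [q <= 2^10] is what allows [slack] to cover the error of the term in [U]. *)
Lemma too_slow_sound n s : (0 < n)%Z -> tracks w y n s -> too_slow alp n s = true -> False.
Proof.
intros Hn Ht Hf.
assert (HD := D_pos); assert (HA := A_pos); assert (Ha := al_bounds).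
assert (Hn' : 0 < IZR n) by now apply (IZR_lt 0).
destruct (tracks_bounds n s Ht) as [H1 H2].
assert (Hl : (0 < lam s)%Z) by apply Ht.
assert (Hb : IZR D * w (IZR n) <= IZR (bnd s)) by apply Ht.
assert (Hs := slack_up s Hl).
unfold too_slow in Hf; cbv zeta in Hf.
set (am := (- pub (pscal (-1) alp))%Z) in *.
set (q := Z.sqrt _) in Hf.
rewrite !andb_true_iff in Hf.
destruct Hf as [[[[Ham Hq] Hc] Hp] Hm].
apply Z.ltb_lt in Ham; apply Z.leb_le in Hq; apply Z.leb_le in Hc.
apply Z.ltb_lt in Hp; apply Z.ltb_lt in Hm.
assert (Hq2 : (q <= 1024)%Z).
{ assert (0 < D * D)%Z by reflexivity.
  assert (0 <= bnd s * bnd s * (A * A))%Z by (assert (0 < A * A)%Z by reflexivity; nia).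
  assert (0 < am * am * (D * D))%Z by nia.
  assert (q * q <= 2 ^ 20)%Z by nia.
  nia. }
apply IZR_le in Hc; apply IZR_lt in Hp; apply IZR_lt in Hm.
apply IZR_le in Hq; apply IZR_le in Hq2; apply IZR_lt in Ham.
rewrite plus_IZR, !mult_IZR in Hp, Hm.
change (IZR (2 ^ 11)) with 2048 in Hp, Hm.
assert (H3 := pev_pub y _ Hy : pev y (padd (pscal (2 ^ 11 * A) (flux_poly n s))
  (pscal (- (q * n)) (pmul alp (val s)))) <= _).
assert (H4 := pev_pub y _ Hy : pev y (padd (pscal (-1) (pscal (2 ^ 11 * A) (flux_poly n s)))
  (pscal (- (q * n)) (pmul alp (val s)))) <= _).
rewrite pev_add, !pev_scal, pev_mul, opp_IZR, !mult_IZR, <- Hal in H3.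
rewrite pev_add, !pev_scal, pev_mul, opp_IZR, !mult_IZR, <- Hal in H4.
change (IZR (2 ^ 11)) with 2048 in H3, H4.
apply Rabs_le_between in H1; apply Rabs_le_between in H2.
set (d := IZR (Z.sqrt (err s) + 1)) in *.
set (d2 := d / IZR (lam s)).
replace (16 * d / IZR (lam s)) with (16 * d2) in H2 by (unfold d2, Rdiv; ring).
replace (8 * d / IZR (lam s)) with (8 * d2) in Hs by (unfold d2, Rdiv; ring).
set (wn := w (IZR n)) in *.
assert (Hwn : 0 < wn) by (apply (proj1 (proj2 (proj2 Hw))); lra).
set (u := IZR n * wn) in *.
assert (Hu : 0 < u) by (apply Rmult_lt_0_compat; assumption).
assert (Hd2 : 0 <= d2) by lra.
assert (H6 : - (IZR q * (IZR A * al * (IZR D * u))) <=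
  - (IZR q * IZR n * (IZR A * al * pev y (val s))) + 2048 * IZR A * (8 * d2)).
{ assert (H7 : IZR A * al * (IZR n * pev y (val s) - IZR D * u) <= IZR A * (16 * d2)).
  { apply Rle_trans with (IZR A * al * (16 * d2)).
    - apply Rmult_le_compat_l; [nra|lra].
    - apply Rmult_le_compat_r; nra. }
  assert (H8 : IZR q * (IZR A * al * (IZR n * pev y (val s) - IZR D * u)) <=
    1024 * (IZR A * (16 * d2))).
  { apply Rle_trans with (IZR q * (IZR A * (16 * d2))).
    - apply Rmult_le_compat_l; assumption.
    - apply Rmult_le_compat_r; [nra|lra]. }
  lra. }
assert (H8 : 2048 * IZR A * (d + 8 * d2) <= 2048 * IZR A * IZR (slack s))
  by (apply Rmult_le_compat_l; lra).
assert (H7 : 2048 * IZR A * (IZR D * flux w (IZR n)) <=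
  2048 * IZR A * (pev y (flux_poly n s) + d)) by (apply Rmult_le_compat_l; lra).
assert (H7' : - (2048 * IZR A * (IZR D * flux w (IZR n))) <=
  2048 * IZR A * (- pev y (flux_poly n s) + d)).
{ rewrite <- Ropp_mult_distr_r_reverse; apply Rmult_le_compat_l; lra. }
set (F := flux w (IZR n)) in *.
assert (HAD : 0 < IZR A * IZR D) by (apply Rmult_lt_0_compat; assumption).
assert (K1 : 2048 * F < IZR q * al * u).
{ apply Rmult_lt_reg_l with (1 := HAD); lra. }
assert (K2 : - (2048 * F) < IZR q * al * u).
{ apply Rmult_lt_reg_l with (1 := HAD); lra. }
assert (K3 : (2048 * F) ^ 2 < (IZR q * al * u) ^ 2) by nra.
assert (K4 := profile_decay_upper _ _ Hw (IZR n) Hn').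
fold wn in K4; fold u in K4; fold F in K4.
rewrite !mult_IZR, minus_IZR, !mult_IZR in Hc.
change (IZR (2 ^ 19)) with 524288 in Hc; change (IZR (2 ^ 20)) with 1048576 in Hc.
assert (Hama : IZR am <= IZR A * al).
{ rewrite Hal; unfold am; rewrite opp_IZR; apply pev_plb; exact Hy. }
assert (Hqq : 0 <= 1048576 - IZR q * IZR q) by nra.
assert (K5 : 524288 * wn ^ 2 <= (1048576 - IZR q * IZR q) * al ^ 2).
{ apply Rmult_le_reg_l with ((IZR A * IZR D) ^ 2); [apply pow_lt; exact HAD|].
  apply Rle_trans with (524288 * (IZR (bnd s) * IZR (bnd s) * (IZR A * IZR A))).
  - assert (L1 : (IZR D * wn) ^ 2 <= IZR (bnd s) ^ 2).
    { apply pow_incr; split; [nra|exact Hb]. }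
    assert (L2 : 0 <= 524288 * IZR A ^ 2) by nra.
    assert (L3 := Rmult_le_compat_l _ _ _ L2 L1); lra.
  - apply Rle_trans with (1 := Hc).
    assert (L1 : IZR am ^ 2 <= (IZR A * al) ^ 2) by (apply pow_incr; lra).
    assert (L2 : 0 <= (1048576 - IZR q * IZR q) * IZR D ^ 2) by nra.
    assert (L3 := Rmult_le_compat_l _ _ _ L2 L1); lra. }
assert (K6 : 0 < u ^ 2) by (apply pow_lt; exact Hu).
assert (K7 : u ^ 2 * (IZR q * IZR q * al ^ 2) <= u ^ 2 * (1048576 * (al ^ 2 - wn ^ 2 / 2))).
{ apply Rmult_le_compat_l; lra. }
lra.
Qed.

Lemma excluded_sound deg fuel : forall n s, (0 <= n)%Z -> tracks w y n s ->
  excluded deg fuel alp n s = true -> False.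
Proof.
induction fuel as [|fuel IH]; intros n s Hn Ht H; [discriminate|].
cbn [excluded] in H; cbv zeta in H.
apply andb_prop in H; destruct H as [Hok H].
assert (Hn1 : (0 < n + 1)%Z) by lia.
destruct (step_sound al w y alp Hw Hy Hal n s (wpoly deg alp n s) _ Hn Ht eq_refl Hok)
  as [Ht' _].
rewrite !orb_true_iff in H; destruct H as [[H|H]|H].
- exact (too_fast_sound _ _ Hn1 Ht' H).
- exact (too_slow_sound _ _ Hn1 Ht' H).
- exact (IH (n + 1)%Z _ ltac:(lia) Ht' H).
Qed.

(** * Tracking the linearized equation *)

Section Linearized.
Variables f g : R -> R.
Hypothesis Hf : forall x, 0 <= x -> continuity_pt f x.
Hypothesis Hg : forall x, 0 <= x -> continuity_pt g x.
Hypothesis Hdf : forall x, 0 < x -> is_derive f x (g x).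
Hypothesis Hdg : forall x, 0 < x -> is_derive g x (- (3 / 4) * w x ^ 2 * f x).
Hypothesis Hf0 : f 0 = 0.
Hypothesis Hg0 : g 0 = 1.

Definition ftracks (n : Z) (s : state) (t : fstate) : Prop :=
  (0 <= ferr t)%Z /\
  (IZR (lam s) / 16) ^ 2 * (IZR D * f (IZR n) - pev y (fval t)) ^ 2 +
  (IZR D * g (IZR n) - pev y (fder t)) ^ 2 <= IZR (ferr t).

Lemma ftracks_start : ftracks 0 start fstart.
Proof.
unfold ftracks, start, fstart; cbn [ferr fval fder lam].
rewrite Hf0, Hg0, pev_cons; change (pev y []) with 0.
split; [lia|right; ring].
Qed.

(** The coefficient of the linearized equation contains [w] itself, whereas the tracked error is
    that of [x w]. *)
Lemma profile_error n s P T x : (0 <= n)%Z -> tracks w y n s ->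
  P = val s :: der s :: T -> step_ok alp P s = true ->
  IZR n < x < IZR n + 1 ->
  let s' := step alp n P s in
  let d := (Z.sqrt (err s') + 1)%Z in
  Rabs (IZR D * w x - qev (x - IZR n) y P) <=
  IZR (if (n =? 0)%Z then d else (16 * d / (lam s' * n) + 1)%Z).
Proof.
intros Hn Ht HP Hok Hx s' d.
destruct (step_sound al w y alp Hw Hy Hal n s P T Hn Ht HP Hok) as [Ht' Hc].
fold s' in Ht', Hc.
assert (He : (0 <= err s')%Z) by apply Ht'.
assert (Hl : (0 < lam s')%Z) by apply Ht'.
assert (Hl' : 0 < IZR (lam s')) by now apply (IZR_lt 0).
destruct (Z.eqb_spec n 0) as [->|Hn0].
- (* In the first cell the error of [x * w x] is the integral of that of its
     derivative. *)
  assert (Hs : forall e, e ^ 2 = 1 ->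
    e * (IZR D * (x * w x) - x * qev (x - 0) y P) <= IZR d * x).
  { intros e He1.
    assert (B := nonincreasing_le
      (fun x => e * (IZR D * (x * w x) - x * qev (x - 0) y P) - IZR d * x)
      (fun x => e * (IZR D * flux w x - (qev (x - 0) y P + x * qev (x - 0) y (qder P))) - IZR d)
      0 x ltac:(lra)).
    cbv beta in B.
    assert (B1 : e * (IZR D * (x * w x) - x * qev (x - 0) y P) - IZR d * x <=
      e * (IZR D * (0 * w 0) - 0 * qev (0 - 0) y P) - IZR d * 0); [|lra].
    apply B.
    - intros t Htt.
      apply (continuity_pt_minus (fun x => e * (IZR D * (x * w x) - x * qev (x - 0) y P))
        (fun x => IZR d * x)).
      + apply (continuity_pt_mult (fun _ => e)
          (fun x => IZR D * (x * w x) - x * qev (x - 0) y P)).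
        * apply continuity_pt_const; intros ? ?; reflexivity.
        * exact (gap_continuity al w y Hw 0 P t).
      + apply derivable_continuous_pt, ex_derive_Reals_0; auto_derive; trivial.
    - intros t Htt.
      assert (C := is_derive_gap al w y Hw 0 P t (proj1 Htt)).
      set (h := fun x => IZR D * (x * w x) - x * qev (x - 0) y P) in *.
      change (is_derive h t
        (IZR D * flux w t - (qev (t - 0) y P + t * qev (t - 0) y (qder P)))) in C.
      change (is_derive (fun x => e * h x - IZR d * x) t
        (e * (IZR D * flux w t - (qev (t - 0) y P + t * qev (t - 0) y (qder P))) - IZR d)).
      auto_derive; [exact (ex_intro _ _ C)|]; rewrite_derive C; ring.
    - intros t Htt.
      destruct (sqrt_err _ _ _ _ Hl He (Hc t ltac:(lra))) as [C _]; fold d in C.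
      assert (C1 := Rle_abs (e * (IZR D * flux w t -
        (qev (t - 0) y P + t * qev (t - 0) y (qder P))))).
      rewrite Rabs_mult in C1.
      replace (Rabs e) with 1 in C1; [lra|].
      assert (E : Rabs e ^ 2 = 1) by (rewrite pow2_abs; exact He1).
      assert (E1 := Rabs_pos e); nra. }
  assert (H1 := Hs 1 ltac:(lra)); assert (H2 := Hs (-1) ltac:(lra)).
  apply Rabs_le; split; apply Rmult_le_reg_l with x; lra.
- assert (Hn1 : 1 <= IZR n) by (apply (IZR_le 1); lia).
  assert (B : (0 < lam s' * n)%Z) by nia.
  apply Rle_trans with (2 := div_up _ _ B).
  destruct (sqrt_err _ _ _ _ Hl He (Hc x ltac:(lra))) as [_ C]; fold d in C.
  rewrite !mult_IZR.
  replace (16 * IZR d / (IZR (lam s') * IZR n)) with (16 * IZR d / IZR (lam s') / IZR n)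
    by (field; lra).
  apply Rle_div_r; [lra|].
  apply Rle_trans with (2 := C).
  replace (IZR D * (x * w x) - x * qev (x - IZR n) y P)
    with (x * (IZR D * w x - qev (x - IZR n) y P)) by ring.
  rewrite Rabs_mult, (Rabs_right x) by lra.
  rewrite Rmult_comm; apply Rmult_le_compat_r; [apply Rabs_pos|lra].
Qed.

(** The source in the error equation has two parts: the residual of [F], and the effect of using [P]
    for [w], written through [w^2 - p^2 = (w - p) (w + p)] and bounded by [profile_error]. *)
Lemma fstep_sound n s P T t F T' : (0 <= n)%Z -> tracks w y n s -> ftracks n s t ->
  P = val s :: der s :: T -> F = fval t :: fder t :: T' ->
  step_ok alp P s = true ->
  let s' := step alp n P s in
  let t' := fstep n P F s s' t in
  (192 * (bnd s * bnd s) <= lam s' * lam s' * (D * D))%Z ->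
  ftracks (n + 1) s' t' /\
  forall x, IZR n <= x <= IZR n + 1 ->
    Rabs (IZR D * g x - qev (x - IZR n) y (qder F)) <= IZR (Z.sqrt (ferr t') + 1) /\
    Rabs (IZR D * f x - qev (x - IZR n) y F) <=
      16 * IZR (Z.sqrt (ferr t') + 1) / IZR (lam s').
Proof.
intros Hn Ht [Hfe Hferr] HP HF Hok s' t' Hk.
assert (HD := D_pos).
assert (Hn' : 0 <= IZR n) by now apply (IZR_le 0).
assert (Hl0 : (0 < lam s)%Z) by apply Ht.
assert (Hl := step_lam alp n P s Hl0); fold s' in Hl.
assert (Hl' : 0 < IZR (lam s')) by (apply (IZR_lt 0); lia).
assert (Hl2 : IZR (lam s') <= IZR (lam s)) by (apply IZR_le; lia).
apply IZR_le in Hk; rewrite !mult_IZR in Hk.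
set (d := (Z.sqrt (err s') + 1)%Z).
set (dw := if (n =? 0)%Z then d else (16 * d / (lam s' * n) + 1)%Z).
set (r := (qabs (fresidual P F) / (4 * (D * D)) + 1
    + 3 * dw * (bnd s + qabs P) * qabs F / (4 * (D * D)) + 1)%Z).
assert (Hcell : forall x, IZR n <= x <= IZR n + 1 ->
  (IZR (lam s') / 16) ^ 2 * (IZR D * f x - qev (x - IZR n) y F) ^ 2 +
  (IZR D * g x - qev (x - IZR n) y (qder F)) ^ 2 <= IZR (ferr t')).
{ intros x Hx.
  assert (Hge : 0 <= IZR (ferr t + 8 * (r * r))) by (apply (IZR_le 0); nia).
  apply Rle_trans with (2 := growth_up _ _ (proj1 Hl) Hge).
  replace (IZR (ferr t + 8 * (r * r))) with (IZR (ferr t) + 8 * IZR r ^ 2)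
    by (rewrite plus_IZR, !mult_IZR; ring).
  apply (gronwall_cell (fun x => IZR D * f x - qev (x - IZR n) y F)
    (fun x => IZR D * g x - qev (x - IZR n) y (qder F))
    (fun x => - (3 / 4) * w x ^ 2)
    (fun x => - (qev (x - IZR n) y (fresidual P F) / (4 * IZR D ^ 2)
      + 3 * (IZR D * w x - qev (x - IZR n) y P) * (IZR D * w x + qev (x - IZR n) y P)
        * qev (x - IZR n) y F / (4 * IZR D ^ 2)))
    (IZR n) x).
  - lra.
  - lra.
  - now apply (IZR_le 0).
  - intros u Hu.
    apply (continuity_pt_minus (fun x => IZR D * f x) (fun x => qev (x - IZR n) y F));
      [|apply qev_shift_continuity].
    apply (continuity_pt_mult (fun _ => IZR D) f); [|apply Hf; lra].
    apply continuity_pt_const; intros ? ?; reflexivity.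
  - intros u Hu.
    apply (continuity_pt_minus (fun x => IZR D * g x) (fun x => qev (x - IZR n) y (qder F)));
      [|apply qev_shift_continuity].
    apply (continuity_pt_mult (fun _ => IZR D) g); [|apply Hg; lra].
    apply continuity_pt_const; intros ? ?; reflexivity.
  - intros u Hu.
    apply (is_derive_minus (fun x => IZR D * f x) (fun x => qev (x - IZR n) y F));
      [|apply is_derive_qev_shift].
    apply (is_derive_scal f); apply Hdf; lra.
  - intros u Hu.
    match goal with |- is_derive _ _ ?l =>
      replace l with (minus (IZR D * (- (3 / 4) * w u ^ 2 * f u))
        (qev (u - IZR n) y (qder (qder F)))) end.
    + apply (is_derive_minus (fun x => IZR D * g x) (fun x => qev (x - IZR n) y (qder F)));
        [|apply is_derive_qev_shift].
      apply (is_derive_scal g); apply Hdg; lra.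
    + unfold fresidual; rewrite qev_add, !qev_scal, !qev_mul, !mult_IZR.
      unfold minus, plus, opp; simpl; field; lra.
  - intros u Hu.
    assert (HW0 : 0 < w u) by (apply (proj1 (proj2 (proj2 Hw))); lra).
    assert (HWb : IZR D * w u <= IZR (bnd s)).
    { apply Rle_trans with (IZR D * w (IZR n)); [|apply Ht].
      apply Rmult_le_compat_l; [lra|]; apply (profile_decr _ _ Hw); lra. }
    assert (B : (IZR D * w u) ^ 2 <= IZR (bnd s) ^ 2) by (apply pow_incr; split; [nra|lra]).
    assert (B1 : IZR D ^ 2 * (192 * w u ^ 2) <= IZR D ^ 2 * IZR (lam s') ^ 2) by lra.
    apply Rmult_le_reg_l in B1; [|apply pow_lt; exact HD].
    assert (B2 := pow2_ge_0 (w u)).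
    rewrite Rabs_left1; lra.
  - intros u Hu.
    assert (Hr := qev_qabs (u - IZR n) y (fresidual P F) ltac:(lra) Hy).
    assert (Hp := qev_qabs (u - IZR n) y P ltac:(lra) Hy).
    assert (HFb := qev_qabs (u - IZR n) y F ltac:(lra) Hy).
    assert (Hdw := profile_error n s P T u Hn Ht HP Hok ltac:(lra)).
    cbv zeta in Hdw; fold s' in Hdw; fold d in Hdw; fold dw in Hdw.
    assert (HW0 : 0 < w u) by (apply (proj1 (proj2 (proj2 Hw))); lra).
    assert (HWb : IZR D * w u <= IZR (bnd s)).
    { apply Rle_trans with (IZR D * w (IZR n)); [|apply Ht].
      apply Rmult_le_compat_l; [lra|]; apply (profile_decr _ _ Hw); lra. }
    set (p := qev (u - IZR n) y P) in *.
    set (q := qev (u - IZR n) y F) in *.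
    set (rr := qev (u - IZR n) y (fresidual P F)) in *.
    rewrite Rabs_Ropp.
    apply Rle_trans with (1 := Rabs_triang _ _).
    assert (B : 0 < / (4 * IZR D ^ 2)).
    { apply Rinv_0_lt_compat; assert (0 < IZR D ^ 2) by (apply pow_lt; exact HD); lra. }
    unfold r; rewrite <- Z.add_assoc, plus_IZR.
    assert (B4 : (0 < 4 * (D * D))%Z) by reflexivity.
    apply Rplus_le_compat.
    + apply Rle_trans with (2 := div_up _ _ B4).
      rewrite !mult_IZR; replace (4 * (IZR D * IZR D)) with (4 * IZR D ^ 2) by ring.
      unfold Rdiv; rewrite Rabs_mult, (Rabs_right (/ (4 * IZR D ^ 2))) by lra.
      apply Rmult_le_compat_r; lra.
    + apply Rle_trans with (2 := div_up _ _ B4).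
      rewrite !mult_IZR, plus_IZR.
      replace (4 * (IZR D * IZR D)) with (4 * IZR D ^ 2) by ring.
      unfold Rdiv; rewrite Rabs_mult, (Rabs_right (/ (4 * IZR D ^ 2))) by lra.
      apply Rmult_le_compat_r; [lra|].
      rewrite !Rabs_mult, (Rabs_right 3) by lra.
      assert (B1 : Rabs (IZR D * w u + p) <= IZR (bnd s) + IZR (qabs P)).
      { apply Rle_trans with (1 := Rabs_triang _ _).
        rewrite (Rabs_right (IZR D * w u)) by nra; lra. }
      apply Rmult_le_compat; [|apply Rabs_pos| |exact HFb].
      * apply Rmult_le_pos; [apply Rmult_le_pos; [lra|apply Rabs_pos]|apply Rabs_pos].
      * apply Rmult_le_compat; [|apply Rabs_pos| |exact B1].
        -- apply Rmult_le_pos; [lra|apply Rabs_pos].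
        -- apply Rmult_le_compat_l; [lra|exact Hdw].
  - apply Rle_trans with (2 := Hferr).
    rewrite Rminus_diag, HF, qev_start, qev_qder_start.
    apply Rplus_le_compat_r, Rmult_le_compat_r; [apply pow2_ge_0|].
    apply pow_incr; lra. }
assert (He' : (0 <= ferr t')%Z).
{ apply le_IZR; apply Rle_trans with (2 := Hcell (IZR n) ltac:(lra)).
  apply Rplus_le_le_0_compat; [apply Rmult_le_pos|]; apply pow2_ge_0. }
split.
- split; [exact He'|].
  specialize (Hcell (IZR n + 1) ltac:(lra)).
  replace (IZR n + 1 - IZR n) with 1 in Hcell by ring.
  rewrite <- !pev_qsum, <- (plus_IZR n 1) in Hcell; exact Hcell.
- intros x Hx; apply (sqrt_err _ _ _ _ (proj1 Hl) He' (Hcell x Hx)).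
Qed.

(** The signs leave room for a single zero of [f] before 14; the remaining conjuncts are the initial
    data of [linearized_tail]. *)
Lemma window_sound deg fuel : forall n s t, (0 <= n)%Z -> (n + Z.of_nat fuel = 14)%Z ->
  tracks w y n s -> ftracks n s t -> window_ok deg fuel alp n s t = true ->
  (forall x, IZR n <= x < 14 ->
     (x < 1 -> 0 < g x) /\ (1 <= x < 4 -> 0 < f x) /\ (4 <= x -> g x < 0)) /\
  flux w 14 < 0 /\ w 14 <= 8 / 100 /\ f 14 < 0 /\ 168 / 10000 * - f 14 < - g 14.
Proof.
assert (HD := D_pos).
induction fuel as [|fuel IH]; intros n s t Hn Hn14 Ht Hft H.
- assert (E : n = 14%Z) by lia; subst n.
  split; [intros x Hx; lra|].
  cbn [window_ok] in H; unfold tail_ok in H; cbv zeta in H.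
  rewrite !andb_true_iff in H; destruct H as [[[H1 H2] H3] H4].
  apply Z.ltb_lt, IZR_lt in H1; apply Z.ltb_lt, IZR_lt in H2.
  apply Z.leb_le, IZR_le in H3; apply Z.ltb_lt, IZR_lt in H4.
  destruct (tracks_bounds _ _ Ht) as [K1 _].
  destruct Ht as [_ [Hl [Hb _]]].
  destruct Hft as [Hfe Hferr].
  destruct (sqrt_err _ _ _ _ Hl Hfe Hferr) as [K2 K3].
  assert (Hl' : 0 < IZR (lam s)) by now apply (IZR_lt 0).
  apply Rabs_le_between in K1; apply Rabs_le_between in K2; apply Rabs_le_between in K3.
  set (d := (Z.sqrt (ferr t) + 1)%Z) in *.
  assert (K4 := div_up (16 * d) (lam s) Hl); rewrite (mult_IZR 16) in K4.
  rewrite <- Z.add_assoc, plus_IZR in H2.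
  rewrite <- Z.add_assoc, !mult_IZR, plus_IZR, minus_IZR, opp_IZR in H4.
  rewrite plus_IZR in H1; rewrite !mult_IZR in H3.
  assert (P1 := pev_pub y (flux_poly 14 s) Hy).
  assert (P2 := pev_pub y (fval t) Hy).
  assert (P3 := pev_plb y (fval t) Hy).
  assert (P4 := pev_pub y (fder t) Hy).
  repeat split; apply Rmult_lt_reg_l with (1 := HD) || apply Rmult_le_reg_l with (1 := HD); lra.
- cbn [window_ok] in H; cbv zeta in H.
  rewrite !andb_true_iff in H; destruct H as [[[Hok Hk] Hs] H].
  apply Z.leb_le in Hk.
  set (P := wpoly deg alp n s) in *.
  set (F := fpoly deg P t) in *.
  destruct (step_sound al w y alp Hw Hy Hal n s P _ Hn Ht eq_refl Hok) as [Ht' _].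
  destruct (fstep_sound n s P _ t F _ Hn Ht Hft eq_refl eq_refl Hok Hk) as [Hft' Hc].
  set (s' := step alp n P s) in *.
  set (t' := fstep n P F s s' t) in *.
  assert (Hl : (0 < lam s')%Z) by apply Ht'.
  destruct (IH (n + 1)%Z s' t' ltac:(lia) ltac:(lia) Ht' Hft' H) as [IH1 IH2].
  split; [|exact IH2].
  intros x Hx; rewrite plus_IZR in IH1.
  destruct (Rle_dec (IZR n + 1) x) as [Hx1|Hx1]; [apply IH1; lra|].
  destruct (Hc x ltac:(lra)) as [C1 C2].
  apply Rabs_le_between in C1; apply Rabs_le_between in C2.
  set (d := (Z.sqrt (ferr t') + 1)%Z) in *.
  assert (K4 := div_up (16 * d) (lam s') Hl); rewrite (mult_IZR 16) in K4.
  unfold sign_ok in Hs; cbv zeta in Hs; fold d in Hs.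
  destruct (Z.eqb_spec n 0) as [E|E]; [subst n|destruct (Z.ltb_spec n 4) as [E4|E4]].
  + apply Z.ltb_lt, IZR_lt in Hs; rewrite plus_IZR in Hs.
    assert (B := qev_qlb (x - 0) y (qder F) ltac:(lra) Hy).
    split; [|split; intros; lra].
    intros _; apply Rmult_lt_reg_l with (1 := HD); lra.
  + apply Z.ltb_lt, IZR_lt in Hs; rewrite <- Z.add_assoc, plus_IZR in Hs.
    assert (B := qev_qlb (x - IZR n) y F ltac:(lra) Hy).
    assert (1 <= IZR n <= 3) by (split; apply IZR_le; lia).
    split; [intros; lra|split; [|intros; lra]].
    intros _; apply Rmult_lt_reg_l with (1 := HD); lra.
  + apply Z.ltb_lt, IZR_lt in Hs; rewrite plus_IZR in Hs.
    assert (B := qev_qub (x - IZR n) y (qder F) ltac:(lra) Hy).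
    assert (4 <= IZR n) by (apply IZR_le; lia).
    split; [intros; lra|split; [intros; lra|]].
    intros _; apply Rmult_lt_reg_l with (1 := HD); lra.
Qed.

End Linearized.
End Exclusion.

(** * The linearized equation *)

(* With [a x = 9/2 w^2 x / (x + 10)] one has [a' + a^2 + 3/4 w^2 <= 0] on
   [14, oo): [a] is a Riccati supersolution, so [- g + a f] stays positive. *)
Lemma linearized_tail (al : R) (w f g : R -> R) :
  profile al w -> 228 / 1000 <= al -> flux w 14 < 0 -> w 14 <= 8 / 100 ->
  (forall x, 0 < x -> is_derive f x (g x)) ->
  (forall x, 0 < x -> is_derive g x (- (3 / 4) * w x ^ 2 * f x)) ->
  f 14 < 0 -> 168 / 10000 * - f 14 < - g 14 ->
  exists c, 0 < c /\ forall x, 14 <= x -> f x < 0 /\ g x <= - c.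
Proof.
intros Hw Hal HV Hw14 Hdf Hdg Hf14 Hg14.
assert (Hpos : forall x, 14 <= x -> 0 < w x).
{ intros x Hx; apply (proj1 (proj2 (proj2 Hw))); lra. }
assert (Hle : forall x, 14 <= x -> w x <= 8 / 100).
{ intros x Hx; apply Rle_trans with (2 := Hw14), (profile_decr _ _ Hw); lra. }
(* Here [al^2 - w^2 / 2 >= 0.228^2 - 0.08^2 / 2 > 0.04], so [x * w x] decays at rate at least 1/10.
   In particular [flux w] cannot vanish and keeps its sign. *)
assert (Hdec : forall x, 14 <= x -> (x * w x) ^ 2 / 100 <= flux w x ^ 2).
{ intros x Hx.
  assert (B := profile_decay_upper _ _ Hw x ltac:(lra)).
  assert (B1 := Hpos x Hx); assert (B2 := Hle x Hx).
  assert (B3 : 4 / 100 <= al ^ 2 - w x ^ 2 / 2) by nra.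
  assert (B4 := pow2_ge_0 (x * w x)); nra. }
assert (HVneg : forall x, 14 <= x -> flux w x < 0).
{ intros x Hx; apply Rnot_le_lt; intros Hn.
  destruct (first_zero (flux w) 14 x) as [c [Hc1 [Hc2 _]]]; try assumption.
  - intros t Ht; apply (flux_continuity _ _ Hw); lra.
  - assert (B := Hdec c ltac:(lra)); rewrite Hc2 in B.
    assert (B1 := Hpos c ltac:(lra)).
    assert (0 < (c * w c) ^ 2) by (apply pow_lt; nra).
    simpl in B; lra. }
assert (HVle : forall x, 14 <= x -> flux w x <= - (x * w x) / 10).
{ intros x Hx; assert (B := Hdec x Hx); assert (B1 := HVneg x Hx).
  assert (B2 := Hpos x Hx); assert (0 < x * w x) by nra; nra. }
assert (Hmom : forall x, 14 <= x -> x * w x <= 112 / 100).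
{ intros x Hx; apply Rle_trans with (14 * w 14); [|lra].
  apply (nonincreasing_le (fun t => t * w t) (flux w)); [exact Hx| | |].
  - intros t Ht; apply (is_derive_continuity_pt _ _ (flux w t)).
    apply (is_derive_moment _ _ Hw); lra.
  - intros t Ht; apply (is_derive_moment _ _ Hw); lra.
  - intros t Ht; left; apply HVneg; lra. }
(* The decay of [x w] gives [(w^2)' <= - (x + 10) / (5 x) w^2], so [15/4 w^2 x / (x + 10)] would
   nearly integrate [3/4 w^2]. Raising 15/4 to 9/2 pays for [a^2] and for the derivative of
   [x / (x + 10)]. *)
set (a := fun x => 9 / 2 * w x ^ 2 * x / (x + 10)).
set (a' := fun x => 9 * w x * (flux w x - w x) / (x + 10) + 45 * w x ^ 2 / (x + 10) ^ 2).
assert (Hda : forall x, 14 <= x -> is_derive a x (a' x)).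
{ intros x Hx; unfold a, a'.
  assert (B := profile_is_derive _ _ Hw x).
  auto_derive.
  - repeat split; [exact (ex_intro _ _ B)|lra].
  - rewrite_derive B; rewrite flux_pos by lra; field; lra. }
assert (Ha0 : forall x, 14 <= x -> 0 < a x).
{ intros x Hx; unfold a; assert (B := Hpos x Hx).
  apply Rdiv_lt_0_compat; [|lra].
  assert (0 < w x ^ 2) by (apply pow_lt; exact B); nra. }
assert (Ha'1 : forall x, 14 <= x ->
  a' x <= - (9 / 10) * w x ^ 2 + 45 * w x ^ 2 / (x + 10) ^ 2).
{ intros x Hx; unfold a'; apply Rplus_le_compat_r.
  apply Rle_div_l; [lra|].
  assert (B := HVle x Hx); assert (B1 := Hpos x Hx).
  assert (B2 : w x * (flux w x - w x) <= w x * (- (x * w x) / 10 - w x))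
    by (apply Rmult_le_compat_l; lra).
  nra. }
assert (Hq1 : forall x, 14 <= x -> w x ^ 2 / (x + 10) ^ 2 <= w x ^ 2 / 576).
{ intros x Hx; apply Rmult_le_compat_l; [apply pow2_ge_0|].
  apply Rinv_le_contravar; [lra|]; nra. }
assert (Hric : forall x, 14 <= x -> 3 / 4 * w x ^ 2 + a' x + a x ^ 2 <= 0).
{ intros x Hx.
  assert (B := Ha'1 x Hx); assert (B1 := Hq1 x Hx).
  assert (B2 : a x ^ 2 <= 45 / 1000 * w x ^ 2).
  { replace (a x ^ 2) with (w x ^ 2 * (81 / 4 * ((x * w x) ^ 2 / (x + 10) ^ 2)))
      by (unfold a; field; lra).
    rewrite (Rmult_comm (45 / 1000)).
    apply Rmult_le_compat_l; [apply pow2_ge_0|].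
    assert (B3 : (x * w x) ^ 2 <= (112 / 100) ^ 2).
    { apply pow_incr; split; [|now apply Hmom].
      assert (C := Hpos x Hx); nra. }
    assert (B4 : (x * w x) ^ 2 / (x + 10) ^ 2 <= (112 / 100) ^ 2 / 576).
    { apply Rmult_le_compat; [apply pow2_ge_0| |exact B3|].
      - left; apply Rinv_0_lt_compat, pow_lt; lra.
      - apply Rinv_le_contravar; [lra|]; nra. }
    lra. }
  assert (B5 := pow2_ge_0 (w x)).
  unfold Rdiv in *; lra. }
(* The inequality [M' >= - a M] alone keeps [M] positive without a uniform bound. As [a <= - 5 a'],
   the factor [exp (- 5 a)], which is at most 1, makes [N] nondecreasing and keeps [M] above
   [N 14]. *)
assert (Hexp : forall x, 14 <= x -> 0 <= - a x - 5 * a' x).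
{ intros x Hx.
  assert (B := Ha'1 x Hx).
  assert (B1 : - a x - 5 * (- (9 / 10) * w x ^ 2 + 45 * w x ^ 2 / (x + 10) ^ 2) =
    w x ^ 2 * (45 * (x + 10) - 225) / (x + 10) ^ 2) by (unfold a; field; lra).
  assert (B2 : 0 <= w x ^ 2 * (45 * (x + 10) - 225) / (x + 10) ^ 2).
  { apply Rmult_le_pos; [apply Rmult_le_pos; [apply pow2_ge_0|lra]|].
    left; apply Rinv_0_lt_compat, pow_lt; lra. }
  lra. }
set (M := fun x => - g x + a x * f x).
set (M' := fun x => f x * (3 / 4 * w x ^ 2 + a' x + a x ^ 2) - a x * M x).
assert (HdM : forall x, 14 <= x -> is_derive M x (M' x)).
{ intros x Hx; unfold M', M.
  assert (B1 := Hdf x ltac:(lra)); assert (B2 := Hdg x ltac:(lra)).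
  assert (B3 := Hda x Hx).
  auto_derive.
  - split; [exact (ex_intro _ _ B2)|split; [exact (ex_intro _ _ B3)|]].
    split; [exact (ex_intro _ _ B1)|trivial].
  - rewrite_derive B1; rewrite_derive B2; rewrite_derive B3; field. }
set (N := fun x => exp (- (5 * a x)) * M x).
assert (HN : forall x, 14 <= x ->
  is_derive N x (exp (- (5 * a x)) * (M' x - 5 * a' x * M x))).
{ intros x Hx; unfold N.
  assert (B1 := HdM x Hx); assert (B2 := Hda x Hx).
  auto_derive.
  - split; [exact (ex_intro _ _ B2)|split; [exact (ex_intro _ _ B1)|trivial]].
  - rewrite_derive B1; rewrite_derive B2; ring. }
assert (HM14 : 0 < M 14).
{ unfold M.
  (* [9/2 * (8/100)^2 * 14/24 = 168/10000], the constant of the hypothesis on [g 14]. *)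
  assert (B : a 14 <= 168 / 10000).
  { unfold a; assert (B1 := Hpos 14 ltac:(lra)); nra. }
  nra. }
assert (Hmono : forall x, 14 <= x -> (forall t, 14 < t < x -> f t < 0 /\ 0 < M t) ->
  N 14 <= N x /\ f x <= f 14).
{ intros x Hx H; split.
  - assert (B := nonincreasing_le (fun t => - N t)
      (fun t => - (exp (- (5 * a t)) * (M' t - 5 * a' t * M t))) 14 x Hx).
    cbv beta in B.
    assert (- N x <= - N 14); [|lra].
    apply B.
    + intros t Ht; apply (continuity_pt_opp N).
      exact (is_derive_continuity_pt _ _ _ (HN t ltac:(lra))).
    + intros t Ht; apply (is_derive_opp N), HN; lra.
    + intros t Ht; destruct (H t Ht) as [H1 H2].
      assert (C := exp_pos (- (5 * a t))).
      assert (C1 := Hric t ltac:(lra)); assert (C2 := Hexp t ltac:(lra)).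
      assert (C3 : 0 <= M' t - 5 * a' t * M t).
      { unfold M'.
        assert (0 <= f t * (3 / 4 * w t ^ 2 + a' t + a t ^ 2)) by nra.
        assert (0 <= (- a t - 5 * a' t) * M t) by nra.
        lra. }
      nra.
  - apply (nonincreasing_le f g); [exact Hx| | |].
    + intros t Ht; exact (is_derive_continuity_pt _ _ _ (Hdf t ltac:(lra))).
    + intros t Ht; apply Hdf; lra.
    + intros t Ht; destruct (H t Ht) as [H1 H2].
      assert (C := Ha0 t ltac:(lra)); unfold M in H2; nra. }
assert (HN14 : 0 < N 14).
{ unfold N; apply Rmult_lt_0_compat; [apply exp_pos|exact HM14]. }
assert (HMN : forall x, 0 < N x -> 0 < M x).
{ intros x Hx; unfold N in Hx; assert (C := exp_pos (- (5 * a x))); nra. }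
assert (Hall : forall x, 14 <= x -> f x < 0 /\ 0 < M x).
{ intros x Hx; apply NNPP; intros Hn.
  (* [k < 0] encodes [f < 0] and [M > 0] together, so that one first zero serves the joint
     continuation argument. *)
  set (k := fun t => Rmax (f t) (- M t)).
  destruct (first_zero k 14 x Hx) as [c [Hc1 [Hc2 Hc3]]].
  - intros t Ht; unfold k.
    apply (continuity_pt_ext (fun t => ((f t + - M t) + Rabs (f t - - M t)) / 2)).
    { intros u; unfold Rmax, Rabs.
      destruct (Rle_dec (f u) (- M u)); destruct (Rcase_abs (f u - - M u)); lra. }
    assert (Cf := is_derive_continuity_pt _ _ _ (Hdf t ltac:(lra))).
    assert (CM := continuity_pt_opp _ _ (is_derive_continuity_pt _ _ _ (HdM t ltac:(lra)))).
    apply (continuity_pt_mult (fun t => f t + - M t + Rabs (f t - - M t)) (fun _ => / 2));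
      [|apply continuity_pt_const; intros ? ?; reflexivity].
    apply (continuity_pt_plus (fun t => f t + - M t) (fun t => Rabs (f t - - M t))).
    + exact (continuity_pt_plus _ _ _ Cf CM).
    + apply (continuity_pt_comp (fun t => f t - - M t) Rabs).
      * exact (continuity_pt_minus _ _ _ Cf CM).
      * apply Rcontinuity_abs.
  - unfold k; apply Rmax_lub_lt; lra.
  - unfold k; apply Rnot_lt_le; intros Hk; apply Hn.
    assert (B1 := Rmax_l (f x) (- M x)); assert (B2 := Rmax_r (f x) (- M x)).
    split; lra.
  - destruct (Hmono c ltac:(lra)) as [D1 D2].
    { intros t Ht; assert (B := Hc3 t ltac:(lra)); unfold k in B.
      assert (B1 := Rmax_l (f t) (- M t)); assert (B2 := Rmax_r (f t) (- M t)).
      split; lra. }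
    assert (D3 := HMN c ltac:(lra)).
    assert (k c < 0) by (unfold k; apply Rmax_lub_lt; lra).
    lra. }
exists (N 14); split; [exact HN14|].
intros x Hx; split; [apply Hall; exact Hx|].
destruct (Hmono x Hx) as [D1 _]; [intros t Ht; apply Hall; lra|].
assert (D2 : N x <= M x).
{ assert (C := proj2 (Hall x Hx)).
  assert (C1 : exp (- (5 * a x)) <= 1).
  { rewrite <- exp_0; apply exp_le; assert (C2 := Ha0 x Hx); lra. }
  unfold N; nra. }
assert (D3 := proj1 (Hall x Hx)); assert (D4 := Ha0 x Hx).
unfold M in D2; nra.
Qed.

(** * Certified parameter intervals *)

Lemma interval_param (lo hi : Z) (al : R) : (lo < hi)%Z ->
  IZR lo <= 10000 * al <= IZR hi ->
  exists y, Rabs y <= 1 /\ IZR A * al = pev y [(lo + hi)%Z; (hi - lo)%Z].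
Proof.
intros Hlt Hal; apply IZR_lt in Hlt.
(* Endpoints are in units of 1/10000; midpoint and half-width are therefore integers in units of
   [1 / A = 1 / 20000]. *)
exists ((20000 * al - IZR lo - IZR hi) / (IZR hi - IZR lo)); split.
- apply Rabs_le; split.
  + apply Rle_div_r; lra.
  + apply Rle_div_l; lra.
- rewrite !pev_cons, plus_IZR, minus_IZR; change (IZR A) with 20000.
  change (pev _ []) with 0; field; lra.
Qed.

Lemma excluded_interval (lo hi : Z) (al : R) (w : R -> R) :
  excluded 11 14 [(lo + hi)%Z; (hi - lo)%Z] 0 start = true -> (lo < hi)%Z ->
  profile al w -> ~ IZR lo <= 10000 * al <= IZR hi.
Proof.
intros He Hlt Hw Hal.
destruct (interval_param lo hi al Hlt Hal) as [y [Hy Ha]].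
exact (excluded_sound al w y _ Hw Hy Ha 11 14 0 start (Z.le_refl 0)
  (tracks_start al w y Hw) He).
Qed.

(** On this interval [am] is 0 in [too_slow], so [too_fast] alone excludes it: as [al] tends to 0
    the equation becomes, in the variable [x / 2], the Lane-Emden equation of index 3, whose
    solution reaches 0 at a finite point. The intervals that follow narrow towards 0.2306, since
    nearby solutions stay close to the ground state for longer. *)
Lemma excluded_0_1800 : excluded 11 14 [0 + 1800; 1800 - 0]%Z 0 start = true.
Proof. vm_compute; reflexivity. Qed.

Lemma excluded_1800_2200 : excluded 11 14 [1800 + 2200; 2200 - 1800]%Z 0 start = true.
Proof. vm_compute; reflexivity. Qed.

Lemma excluded_2200_2280 : excluded 11 14 [2200 + 2280; 2280 - 2200]%Z 0 start = true.
Proof. vm_compute; reflexivity. Qed.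

Lemma excluded_2320_2450 : excluded 11 14 [2320 + 2450; 2450 - 2320]%Z 0 start = true.
Proof. vm_compute; reflexivity. Qed.

Lemma excluded_2450_2700 : excluded 11 14 [2450 + 2700; 2700 - 2450]%Z 0 start = true.
Proof. vm_compute; reflexivity. Qed.

Lemma excluded_2700_3200 : excluded 11 14 [2700 + 3200; 3200 - 2700]%Z 0 start = true.
Proof. vm_compute; reflexivity. Qed.

Lemma excluded_3200_4600 : excluded 11 14 [3200 + 4600; 4600 - 3200]%Z 0 start = true.
Proof. vm_compute; reflexivity. Qed.

Lemma excluded_4600_6000 : excluded 11 14 [4600 + 6000; 6000 - 4600]%Z 0 start = true.
Proof. vm_compute; reflexivity. Qed.

(** 7072 exceeds [10000 / sqrt 2], the upper limit given by [profile_al_le]. *)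
Lemma excluded_6000_7072 : excluded 11 14 [6000 + 7072; 7072 - 6000]%Z 0 start = true.
Proof. vm_compute; reflexivity. Qed.

Lemma window_checked : window_ok 12 14 [2280 + 2320; 2320 - 2280]%Z 0 start fstart = true.
Proof. vm_compute; reflexivity. Qed.

Lemma profile_window al w : profile al w -> 2280 <= 10000 * al <= 2320.
Proof.
intros Hw.
assert (Ha := proj1 Hw); assert (Ha2 := profile_al_le _ _ Hw).
assert (H7 : 10000 * al <= 7072) by nra.
assert (L1 := excluded_interval _ _ al w excluded_0_1800 eq_refl Hw).
assert (L2 := excluded_interval _ _ al w excluded_1800_2200 eq_refl Hw).
assert (L3 := excluded_interval _ _ al w excluded_2200_2280 eq_refl Hw).
assert (H1 := excluded_interval _ _ al w excluded_2320_2450 eq_refl Hw).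
assert (H2 := excluded_interval _ _ al w excluded_2450_2700 eq_refl Hw).
assert (H3 := excluded_interval _ _ al w excluded_2700_3200 eq_refl Hw).
assert (H4 := excluded_interval _ _ al w excluded_3200_4600 eq_refl Hw).
assert (H5 := excluded_interval _ _ al w excluded_4600_6000 eq_refl Hw).
assert (H6 := excluded_interval _ _ al w excluded_6000_7072 eq_refl Hw).
lra.
Qed.

(** Between [x0] and 14 the function [f] is nonpositive, so [g] is nondecreasing there and inherits
    the bound that the tail estimate gives at 14. *)
Lemma linearized_unique_zero (al : R) (w f g : R -> R) (x0 : R) :
  profile al w ->
  (forall x, 0 <= x -> continuity_pt f x) ->
  (forall x, 0 <= x -> continuity_pt g x) ->
  (forall x, 0 < x -> is_derive f x (g x)) ->
  (forall x, 0 < x -> is_derive g x (- (3 / 4) * w x ^ 2 * f x)) ->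
  f 0 = 0 -> g 0 = 1 ->
  0 < x0 -> f x0 = 0 -> (forall x, 0 < x < x0 -> f x <> 0) ->
  exists c, 0 < c /\ forall x, x0 <= x -> g x <= - c.
Proof.
intros Hw Hf Hg Hdf Hdg Hf0 Hg0 Hx0 Hfx0 Hne.
assert (Hwin := profile_window _ _ Hw).
destruct (interval_param 2280 2320 al eq_refl Hwin) as [y [Hy Ha]].
destruct (window_sound al w y _ Hw Hy Ha f g Hf Hg Hdf Hdg 12 14 0 start fstart
  (Z.le_refl 0) eq_refl (tracks_start al w y Hw) (ftracks_start y f g Hf0 Hg0) window_checked)
  as [Hsign [HV [Hw14 [Hf14 Hg14]]]].
destruct (linearized_tail al w f g Hw ltac:(lra) HV Hw14 Hdf Hdg Hf14 Hg14) as [c [Hc Htail]].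
exists c; split; [exact Hc|].
assert (Hfpos : forall x, 0 < x < 4 -> 0 < f x).
{ intros x Hx; destruct (Rlt_dec x 1) as [Hx1|Hx1].
  - rewrite <- Hf0; apply (increasing_lt f g); [lra| | |].
    + intros t Ht; apply Hf; lra.
    + intros t Ht; apply Hdf; lra.
    + intros t Ht; apply Hsign; lra.
  - apply Hsign; lra. }
assert (Hx04 : 4 <= x0).
{ apply Rnot_lt_le; intros Hlt; assert (B := Hfpos x0 ltac:(lra)); lra. }
assert (Hx014 : x0 < 14).
{ destruct (first_zero (fun x => - f x) 1 14) as [z [Hz1 [Hz2 _]]]; try lra.
  - intros x Hx; apply (continuity_pt_opp f), Hf; lra.
  - assert (B := Hfpos 1 ltac:(lra)); lra.
  - destruct (Rlt_dec z x0) as [Hzx|Hzx].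
    + exfalso; apply (Hne z); lra.
    + destruct (Req_dec z 14) as [E|E]; [rewrite E in Hz2|]; lra. }
assert (Hfneg : forall x, x0 < x < 14 -> f x <= 0).
{ intros x Hx; rewrite <- Hfx0; apply (nonincreasing_le f g); [lra| | |].
  - intros t Ht; apply Hf; lra.
  - intros t Ht; apply Hdf; lra.
  - intros t Ht; left; apply Hsign; lra. }
intros x Hx; destruct (Rle_dec 14 x) as [Hx14|Hx14]; [apply Htail; exact Hx14|].
apply Rle_trans with (g 14); [|apply Htail; lra].
assert (B := nonincreasing_le (fun t => - g t) (fun t => - (- (3 / 4) * w t ^ 2 * f t)) x 14).
cbv beta in B.
assert (- g 14 <= - g x); [|lra].
apply B; [lra| | |].
- intros t Ht; apply (continuity_pt_opp g), Hg; lra.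
- intros t Ht; apply (is_derive_opp g), Hdg; lra.
- intros t Ht; assert (C := Hfneg t ltac:(lra)); assert (C1 := pow2_ge_0 (w t)); nra.
Qed.

(** [gronwall_cell] with zero initial error and zero source, iterated over unit cells. *)
Lemma linear_ode_unique (y z k : R -> R) (lam : R) :
  0 < lam ->
  (forall x, 0 <= x -> continuity_pt y x) ->
  (forall x, 0 <= x -> continuity_pt z x) ->
  (forall x, 0 < x -> is_derive y x (z x)) ->
  (forall x, 0 < x -> is_derive z x (k x * y x)) ->
  (forall x, 0 < x -> Rabs (k x) <= lam ^ 2) ->
  y 0 = 0 -> z 0 = 0 -> forall x, 0 <= x -> y x = 0.
Proof.
intros Hlam Hcy Hcz Hy Hz Hk Hy0 Hz0.
assert (Hstep : forall a b, 0 <= a -> a <= b <= a + 1 -> y a = 0 -> z a = 0 ->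
  y b = 0 /\ z b = 0).
{ intros a b Ha Hab Hya Hza.
  assert (B := gronwall_cell y z k (fun _ => 0) a b lam 0 0 Hlam Hab (Rle_refl 0)).
  assert (C : lam ^ 2 * y b ^ 2 + z b ^ 2 <= exp (2 * lam + 1 / 8) * (0 + 8 * 0 ^ 2)).
  { apply B.
    - intros x Hx; apply Hcy; lra.
    - intros x Hx; apply Hcz; lra.
    - intros x Hx; apply Hy; lra.
    - intros x Hx; rewrite Rplus_0_r; apply Hz; lra.
    - intros x Hx; apply Hk; lra.
    - intros x Hx; rewrite Rabs_R0; lra.
    - rewrite Hya, Hza; right; ring. }
  replace (exp (2 * lam + 1 / 8) * (0 + 8 * 0 ^ 2)) with 0 in C by ring.
  assert (C1 := pow2_ge_0 (lam * y b)); assert (C2 := pow2_ge_0 (z b)).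
  rewrite Rpow_mult_distr in C1.
  assert (C3 : z b ^ 2 = 0) by lra.
  assert (C4 : (lam * y b) ^ 2 = 0) by (rewrite Rpow_mult_distr; lra).
  split; [|nra].
  assert (C5 : lam * y b = 0) by nra.
  apply Rmult_integral in C5; lra. }
assert (Hn : forall n, y (INR n) = 0 /\ z (INR n) = 0).
{ induction n as [|n [IH1 IH2]]; [split; assumption|].
  rewrite S_INR; apply (Hstep (INR n)); try assumption; [apply pos_INR|lra]. }
intros x Hx.
destruct (nfloor_ex x Hx) as [n Hn1].
destruct (Hn n) as [H1 H2].
apply (Hstep (INR n) x); try assumption; [apply pos_INR|lra].
Qed.

(** * Return to the original variables *)

Lemma radial_ground_state_profile (Q : R -> R) : radial_ground_state Q ->
  profile (/ Q 0) (fun x => / Q 0 * Q (/ Q 0 / 2 * x)).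
Proof.
intros [Hpos [Hder [_ [Hode Hlim]]]].
assert (HQ0 := Hpos 0 (Rle_refl 0)).
set (al := / Q 0).
assert (Hal : 0 < al) by now apply Rinv_0_lt_compat.
assert (Hd : forall x, is_derive (fun x => al * Q (al / 2 * x)) x
  (al ^ 2 / 2 * Derive Q (al / 2 * x))).
{ intros x; assert (B := Derive_correct Q (al / 2 * x) (Hder _)).
  auto_derive; [exact (ex_intro _ _ B)|].
  change (Derive (fun t => Q t) (al / 2 * x)) with (Derive Q (al / 2 * x)); field. }
split; [|split; [|split; [|split; [|split]]]].
- exact Hal.
- rewrite Rmult_0_r; apply Rinv_l; lra.
- intros x Hx; apply Rmult_lt_0_compat; [exact Hal|]; apply Hpos; nra.
- intros x; exact (ex_intro _ _ (Hd x)).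
- intros x Hx.
  assert (HD1 : forall x, Derive (fun x : R => al * Q (al / 2 * x)) x =
    al ^ 2 / 2 * Derive Q (al / 2 * x)) by (intros; apply is_derive_unique, Hd).
  rewrite HD1.
  apply (is_derive_ext (fun x => al ^ 2 / 2 * Derive Q (al / 2 * x))).
  { intros t; symmetry; apply HD1. }
  assert (Hx' : 0 < al / 2 * x) by nra.
  assert (B := Hode _ Hx').
  set (dQ := Derive Q) in *.
  auto_derive; [exact (ex_intro _ _ B)|].
  rewrite_derive B; field; lra.
- replace (Finite 0) with (Rbar_mult al 0) by (simpl; f_equal; ring).
  apply is_lim_scal_l.
  apply (is_lim_ext (fun x => Q (al / 2 * x + 0))); [intros; f_equal; ring|].
  apply is_lim_comp_lin; [|lra].
  replace (Rbar_plus (Rbar_mult (al / 2) p_infty) 0) with p_infty; [exact Hlim|].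
  symmetry; simpl.
  destruct (Rle_dec 0 (al / 2)) as [H|H]; [|lra].
  destruct (Rle_lt_or_eq_dec 0 (al / 2) H) as [H1|H1]; [reflexivity|lra].
Qed.

Theorem theorem6p1 (Q F0 q : R -> R) (t0 : R) :
  radial_ground_state Q ->
  solves_ivp Q 0 (-1) F0 ->
  first_pos_zero F0 t0 ->
  solves_ivp (fun t => Q (t + t0)) 0 1 q ->
  (forall t, 0 < t -> 0 < q t) /\
  (exists c0, 0 < c0 /\ forall t, 1 <= t -> c0 <= q t / t).
Proof.
intros HQ [HFd [HF0 [HF1 HFode]]] [Ht0 [HFt0 HFne]] [Hqd [Hq0 [Hq1 Hqode]]].
assert (Hw := radial_ground_state_profile Q HQ).
destruct HQ as [HQpos [HQd _]].
set (al := / Q 0) in *.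
set (w := fun x => al * Q (al / 2 * x)) in *.
assert (Hal : 0 < al) by apply Hw.
assert (HQle : forall t, 0 <= t -> Q t <= / al).
{ intros t Ht.
  assert (B := profile_le_1 _ _ Hw (2 / al * t)).
  assert (B0 : 0 <= 2 / al * t).
  { apply Rmult_le_pos; [|exact Ht]; left; apply Rdiv_lt_0_compat; lra. }
  specialize (B B0); unfold w in B.
  replace (al / 2 * (2 / al * t)) with t in B by (field; lra).
  apply Rmult_le_reg_l with (1 := Hal); rewrite Rinv_r; lra. }
set (f := fun x => - (2 / al) * F0 (al / 2 * x)).
set (g1 := fun x => - Derive F0 (al / 2 * x)).
(* The value on [x <= 0] is set to 1, because the equation controls [Derive F0] only to the right of
   0. *)
set (g := fun x => if Rle_dec x 0 then 1 else g1 x).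
assert (HdF : forall t, is_derive F0 t (Derive F0 t)) by (intros; apply Derive_correct, HFd).
assert (Hdf1 : forall x, is_derive f x (g1 x)).
{ intros x; unfold f, g1; assert (B := HdF (al / 2 * x)).
  auto_derive; [exact (ex_intro _ _ B)|].
  rewrite_derive B; field; lra. }
assert (Hdg1 : forall x, 0 < x -> is_derive g1 x (- (3 / 4) * w x ^ 2 * f x)).
{ intros x Hx; unfold g1, w, f.
  assert (B := HFode (al / 2 * x) ltac:(nra)).
  set (dF := Derive F0) in *.
  auto_derive; [exact (ex_intro _ _ B)|].
  rewrite_derive B; field; lra. }
assert (Hgpos : forall x, 0 < x -> g x = g1 x).
{ intros x Hx; unfold g; destruct (Rle_dec x 0); [lra|reflexivity]. }
assert (Hdf : forall x, 0 < x -> is_derive f x (g x)).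
{ intros x Hx; rewrite Hgpos by exact Hx; apply Hdf1. }
assert (Hdg : forall x, 0 < x -> is_derive g x (- (3 / 4) * w x ^ 2 * f x)).
{ intros x Hx; apply (is_derive_ext_pos g1); [exact Hx| |now apply Hdg1].
  intros; symmetry; now apply Hgpos. }
assert (Hf : forall x, 0 <= x -> continuity_pt f x).
{ intros x _; exact (is_derive_continuity_pt _ _ _ (Hdf1 x)). }
assert (Hg : forall x, 0 <= x -> continuity_pt g x).
{ intros x Hx; destruct (Req_dec x 0) as [->|Hne].
  - apply (derivative_right_continuous f g1 (fun x => - (3 / 4) * w x ^ 2 * f x)).
    + replace 1 with (g1 0); [apply Hdf1|].
      unfold g1; rewrite Rmult_0_r, HF1; ring.
    + intros; apply Hdf1.
    + exact Hdg1.
    + apply derivable_continuous_pt, ex_derive_Reals_0.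
      assert (B1 := profile_is_derive _ _ Hw 0); assert (B2 := Hdf1 0).
      auto_derive; split; [exact (ex_intro _ _ B1)|split; [exact (ex_intro _ _ B2)|trivial]].
  - exact (is_derive_continuity_pt _ _ _ (Hdg x ltac:(lra))). }
assert (Hf0 : f 0 = 0) by (unfold f; rewrite Rmult_0_r, HF0; ring).
assert (Hg0 : g 0 = 1) by (unfold g; destruct (Rle_dec 0 0); [reflexivity|lra]).
set (x0 := 2 / al * t0).
assert (Hx0 : 0 < x0) by (apply Rmult_lt_0_compat; [apply Rdiv_lt_0_compat|]; lra).
assert (Hx0t : al / 2 * x0 = t0) by (unfold x0; field; lra).
destruct (linearized_unique_zero al w f g x0 Hw Hf Hg Hdf Hdg Hf0 Hg0 Hx0) as [c [Hc Hgc]].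
{ unfold f; rewrite Hx0t, HFt0; ring. }
{ intros x Hx Hfx; apply (HFne (al / 2 * x)).
  - split; [nra|]; rewrite <- Hx0t; apply Rmult_lt_compat_l; lra.
  - unfold f in Hfx.
    apply Rmult_integral in Hfx; destruct Hfx as [E|E]; [|exact E].
    assert (0 < 2 / al) by (apply Rdiv_lt_0_compat; lra); lra. }
(* Both [F0 (t + t0)] and [m * q t] vanish at [t = 0] with derivative [m], so uniqueness will
   identify them. *)
set (m := Derive F0 t0).
assert (Hm : c <= m).
{ assert (B := Hgc x0 (Rle_refl x0)); rewrite Hgpos in B by exact Hx0.
  unfold g1 in B; rewrite Hx0t in B; unfold m; lra. }
assert (Hgrow : forall t, 0 <= t -> c * t <= F0 (t + t0)).
{ intros t Ht.
  assert (B := nonincreasing_le (fun s => c * s - F0 (s + t0))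
    (fun s => c - Derive F0 (s + t0)) 0 t Ht).
  cbv beta in B.
  assert (Hd : forall s, is_derive (fun s => c * s - F0 (s + t0)) s (c - Derive F0 (s + t0))).
  { intros s; assert (C := HdF (s + t0)).
    auto_derive; [exact (ex_intro _ _ C)|]; rewrite_derive C; ring. }
  assert (C : c * t - F0 (t + t0) <= c * 0 - F0 (0 + t0)).
  { apply B.
    - intros s Hs; exact (is_derive_continuity_pt _ _ _ (Hd s)).
    - intros; apply Hd.
    - intros s Hs.
      assert (Hs0 : 0 < 2 / al * s) by (apply Rmult_lt_0_compat; [apply Rdiv_lt_0_compat|]; lra).
      assert (E := Hgc (x0 + 2 / al * s) ltac:(lra)).
      rewrite Hgpos in E by lra; unfold g1 in E.
      replace (al / 2 * (x0 + 2 / al * s)) with (s + t0) in E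
        by (unfold x0; field; lra).
      lra. }
  rewrite Rplus_0_l, HFt0 in C; lra. }
assert (Hqm : forall t, 0 <= t -> m * q t - F0 (t + t0) = 0).
{ set (qd := fun t => if Rle_dec t 0 then 1 else Derive q t).
  assert (Hqdpos : forall t, 0 < t -> qd t = Derive q t).
  { intros t Ht; unfold qd; destruct (Rle_dec t 0); [lra|reflexivity]. }
  assert (Hdq : forall t, is_derive q t (Derive q t)) by (intros; apply Derive_correct, Hqd).
  assert (Hdqd : forall t, 0 < t -> is_derive qd t (- 3 * Q (t + t0) ^ 2 * q t)).
  { intros t Ht; apply (is_derive_ext_pos (Derive q)); [exact Ht| |now apply Hqode].
    intros; symmetry; now apply Hqdpos. }
  assert (HdFd : forall t, 0 <= t ->
    is_derive (fun t => Derive F0 (t + t0)) t (- 3 * Q (t + t0) ^ 2 * F0 (t + t0))).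
  { intros t Ht; assert (B := HFode (t + t0) ltac:(lra)).
    set (dF := Derive F0) in *.
    auto_derive; [exact (ex_intro _ _ B)|]; rewrite_derive B; ring. }
  (* The rate [2 / al] suffices because [Q <= 1 / al] gives [3 Q^2 <= 4 / al^2]. *)
  apply (linear_ode_unique (fun t => m * q t - F0 (t + t0))
    (fun t => m * qd t - Derive F0 (t + t0)) (fun t => - 3 * Q (t + t0) ^ 2) (2 * / al)).
  - assert (0 < / al) by now apply Rinv_0_lt_compat.
    lra.
  - intros t Ht; apply derivable_continuous_pt, ex_derive_Reals_0.
    auto_derive; repeat split; [apply Hqd|apply HFd].
  - intros t Ht.
    apply (continuity_pt_minus (fun t => m * qd t) (fun t => Derive F0 (t + t0))).
    + apply (continuity_pt_mult (fun _ => m) qd).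
      * apply continuity_pt_const; intros ? ?; reflexivity.
      * destruct (Req_dec t 0) as [->|Hne];
          [|exact (is_derive_continuity_pt _ _ _ (Hdqd t ltac:(lra)))].
        apply (derivative_right_continuous q (Derive q)
          (fun t => - 3 * Q (t + t0) ^ 2 * q t)).
        -- rewrite <- Hq1; apply Hdq.
        -- intros; apply Hdq.
        -- exact Hqode.
        -- apply derivable_continuous_pt, ex_derive_Reals_0.
           auto_derive; repeat split; [apply HQd|apply Hqd].
    + exact (is_derive_continuity_pt _ _ _ (HdFd t Ht)).
  - intros t Ht; rewrite Hqdpos by exact Ht.
    assert (B1 := Hdq t); assert (B2 := HdF (t + t0)).
    auto_derive.
    + split; [exact (ex_intro _ _ B1)|split; [exact (ex_intro _ _ B2)|trivial]].
    + rewrite_derive B1; rewrite_derive B2; ring.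
  - intros t Ht.
    replace (- 3 * Q (t + t0) ^ 2 * (m * q t - F0 (t + t0)))
      with (minus (m * (- 3 * Q (t + t0) ^ 2 * q t)) (- 3 * Q (t + t0) ^ 2 * F0 (t + t0)))
      by (unfold minus, plus, opp; simpl; ring).
    apply (is_derive_minus (fun t => m * qd t) (fun t => Derive F0 (t + t0))).
    + apply (is_derive_scal qd), Hdqd; exact Ht.
    + apply HdFd; lra.
  - intros t Ht.
    assert (B := HQle (t + t0) ltac:(lra)); assert (B1 := HQpos (t + t0) ltac:(lra)).
    assert (B2 : Q (t + t0) ^ 2 <= (/ al) ^ 2) by (apply pow_incr; lra).
    rewrite Rabs_left1; nra.
  - rewrite Hq0, Rplus_0_l, HFt0; ring.
  - rewrite Rplus_0_l; fold m; unfold qd; destruct (Rle_dec 0 0); [ring|lra]. }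
assert (Hq : forall t, 0 <= t -> c / m * t <= q t).
{ intros t Ht; assert (B := Hqm t Ht); assert (B1 := Hgrow t Ht).
  apply Rmult_le_reg_l with m; [lra|].
  replace (m * (c / m * t)) with (c * t) by (field; lra); lra. }
assert (Hcm : 0 < c / m) by (apply Rdiv_lt_0_compat; lra).
split.
- intros t Ht; apply Rlt_le_trans with (2 := Hq t ltac:(lra)); nra.
- exists (c / m); split; [exact Hcm|].
  intros t Ht; apply (proj1 (Rle_div_r (c / m) (q t) t ltac:(lra))), Hq; lra.
Qed.
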